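(* There exists a reflexive Banach space $X$ with an unconditional (Schauder) basis such that $X$ admits a unique $\ell_1$ asymptotic model with respect to $\mathscr{F}_0(X)$ (that is, every asymptotic model generated by an infinite array of normalized weakly null sequences in $X$ is equivalent to the unit vector basis of $\ell_1$), and $X$ is not an Asymptotic $\ell_1$ space.
   Context: All Banach spaces are infinite dimensional. $\mathbb{N}=\{1,2,\dots\}$. $\mathscr{F}_0(X)$ denotes the class of normalized weakly null sequences in $X$. Asymptotic model: an infinite array of sequences $(x^i_j)_{j}$, $i\in\mathbb{N}$, in $X$ generates a sequence $(e_i)_i$ in a seminormed space $E$ as an asymptotic model if for every $\varepsilon>0$ and $n\in\mathbb{N}$ there is $k_0\in\mathbb{N}$ such that for all natural numbers $k_0\le k_1<\dots<k_n$ and all scalars $a_1,\dots,a_n\in[-1,1]$, $$\Big|\,\big\|\sum_{i=1}^n a_i x^i_{k_i}\big\|-\big\|\sum_{i=1}^n a_i e_i\big\|\,\Big|<\varepsilon .$$ Asymptotic $\ell_1$: for $n\in\mathbb{N}$ and $C\ge 1$ let $G(n,1,C)$ be the two-player $n$-turn game in which, in turn $k=1,\dots,n$, player (S) picks a finite codimensional subspace $Y_k$ of $X$ and then player (V) picks a normalized vector $x_k\in Y_k$; player (S) wins if $(x_k)_{k=1}^n$ is $C$-equivalent to the unit vector basis of $\ell_1^n$. $X$ is Asymptotic $\ell_1$ if there is a constant $C$ such that for every $n\in\mathbb{N}$ player (S) has a winning strategy in $G(n,1,C)$. *)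

(* Defs.v *)
From HB Require Import structures.
From mathcomp Require Import all_boot all_order all_algebra.
From mathcomp Require Import all_classical all_reals all_analysis.

Set Implicit Arguments.
Unset Strict Implicit.
Unset Printing Implicit Defensive.

Import Order.TTheory GRing.Theory Num.Theory.
Import numFieldNormedType.Exports.

Local Open Scope classical_set_scope.
Local Open Scope ring_scope.

Section Dual.
Context {R : realType} (X : normedModType R).

Definition continuous_functional : {pred X -> R^o} :=
  fun f => `[< linear f /\ continuous f >].

Record dual := Dual {
  dual_fun :> X -> R^o ;
  dual_funP : dual_fun \in continuous_functional }.

HB.instance Definition _ := [isSub for dual_fun].
HB.instance Definition _ := gen_eqMixin dual.
HB.instance Definition _ := gen_choiceMixin dual.

Lemma continuous_functional_submod_closed :
  submod_closed continuous_functional.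
Proof.
split.
  apply/asboolP; split; last exact: cst_continuous.
  by move=> a u v; rewrite /= scaler0 addr0.
move=> a f g /asboolP[lf cf] /asboolP[lg cg]; apply/asboolP; split.
  move=> b u v.
  change (a *: f (b *: u + v) + g (b *: u + v) =
          b *: (a *: f u + g u) + (a *: f v + g v)).
  by rewrite lf lg !scalerDr !scalerA (mulrC a b) addrACA.
by move=> x; apply: cvgD; [apply: cvgZl_tmp; exact: cf|exact: cg].
Qed.

HB.instance Definition _ := GRing.isSubmodClosed.Build R (X -> R^o)
  continuous_functional continuous_functional_submod_closed.
HB.instance Definition _ := [SubChoice_isSubLmodule of dual by <:].

Implicit Types f g : dual.

Definition dual_norm f : R := sup [set `|f x| | x in [set x | `|x| <= 1]].

Lemma dualP f a u v : f (a *: u + v) = a *: f u + f v.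
Proof. by have /asboolP[+ _] := dual_funP f; exact. Qed.

Lemma dual_continuous f : continuous f.
Proof. by have /asboolP[] := dual_funP f. Qed.

Lemma dual0 f : f 0 = 0.
Proof.
have := dualP f 1 0 0; rewrite !scale1r addr0 => /eqP.
by rewrite -subr_eq0 opprD addrA subrr sub0r oppr_eq0 => /eqP.
Qed.

Lemma dualZ f a u : f (a *: u) = a *: f u.
Proof. by rewrite -[a *: u]addr0 dualP dual0 addr0. Qed.

Lemma dual_norm_has_sup f : has_sup [set `|f x| | x in [set x | `|x| <= 1]].
Proof.
split; first by exists `|f 0|, 0 => //=; rewrite normr0.
have /cvgrPdist_le/(_ 1 ltr01) := @dual_continuous f 0.
rewrite dual0 => /nbhs_normP[e /= e0 He].
exists (2 / e) => _ [x /= x1 <-].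
have e20 : 0 < e / 2 by rewrite divr_gt0.
have xe : `|(e / 2) *: x| < e.
  rewrite normrZ gtr0_norm// (@le_lt_trans _ _ (e / 2))//.
    by rewrite ler_piMr// ltW.
  by rewrite gtr_pMr// invf_lt1// ltr1n.
have := He ((e / 2) *: x); rewrite /= !sub0r !normrN => /(_ xe).
by rewrite dualZ normrZ (gtr0_norm e20) -ler_pdivlMl// invf_div mulr1.
Qed.

Lemma dual_norm_ub f x : `|x| <= 1 -> `|f x| <= dual_norm f.
Proof. by move=> x1; apply: sup_upper_bound (dual_norm_has_sup f) _ _; exists x. Qed.

Lemma dual_norm_le f M :
  (forall x, `|x| <= 1 -> `|f x| <= M) -> dual_norm f <= M.
Proof.
move=> fM; apply: ge_sup; first by case: (dual_norm_has_sup f).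
by move=> _ [x x1 <-]; exact: fM.
Qed.

Lemma dual_normD f g : dual_norm (f + g) <= dual_norm f + dual_norm g.
Proof.
by apply: dual_norm_le => x x1; rewrite (le_trans (ler_normD _ _))// lerD//
  dual_norm_ub.
Qed.

Lemma dual_norm_ge0 f : 0 <= dual_norm f.
Proof. by apply: le_trans (@dual_norm_ub f 0 _); rewrite ?normr0. Qed.

Lemma dual_normZ_le a f : dual_norm (a *: f) <= `|a| * dual_norm f.
Proof.
apply: dual_norm_le => x x1.
have -> : (a *: f : dual) x = a * f x by [].
by rewrite normrM ler_wpM2l// dual_norm_ub.
Qed.

Lemma dual_normZ a f : dual_norm (a *: f) = `|a| * dual_norm f.
Proof.
apply/eqP; rewrite eq_le dual_normZ_le/=.
have [->|a0] := eqVneq a 0; first by rewrite normr0 mul0r dual_norm_ge0.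
rewrite -ler_pdivlMl ?normr_gt0// -normfV.
by rewrite -{1}[f](scalerK a0) dual_normZ_le.
Qed.

Lemma dual_norm0_eq0 f : dual_norm f = 0 -> f = 0.
Proof.
move=> f0; apply/val_inj/funext => x /=.
have [->|x0] := eqVneq x 0; first by rewrite dual0.
have nx0 : `|x| != 0 by rewrite normr_eq0.
have := @dual_norm_ub f (`|x|^-1 *: x).
rewrite normrZ normfV normr_id mulVf// => /(_ (lexx _)).
by rewrite f0 normr_le0 dualZ scaler_eq0 invr_eq0 (negbTE nx0) => /eqP.
Qed.

HB.instance Definition _ := Lmodule_isNormed.Build R dual
  dual_normD dual_normZ dual_norm0_eq0.

End Dual.

Section BanachSpaces.
Context {R : realType}.
Implicit Types X : normedModType R.

(* The canonical isometry of X into its bidual is onto. *)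
Definition reflexive_space X :=
  forall phi : dual (dual X), exists x : X, forall f : dual X, phi f = f x.

(* The vectors v_0, ..., v_(n-1) span the quotient of X by Y. *)
Definition finite_codim X (Y : set X) :=
  exists (n : nat) (v : 'I_n -> X), forall x : X,
    exists2 y, Y y & exists a : 'I_n -> R, x = y + \sum_(i < n) a i *: v i.

Definition infinite_dimensional X :=
  ~ exists (n : nat) (v : 'I_n -> X), forall x : X,
      exists a : 'I_n -> R, x = \sum_(i < n) a i *: v i.

Definition linear_subspace X (Y : set X) :=
  Y 0 /\ forall (a : R) (u v : X), Y u -> Y v -> Y (a *: u + v).

(* As usual for Banach spaces, subspaces are closed. *)
Definition finite_codim_subspace X (Y : set X) :=
  [/\ linear_subspace Y, closed Y & finite_codim Y].

Definition schauder_basis X (b : nat -> X) :=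
  forall x : X, exists! a : nat -> R,
    series (fun i => a i *: b i) @ \oo --> x.

(* The expansion of every vector converges unconditionally, i.e. all its
   rearrangements converge. *)
Definition unconditional_basis X (b : nat -> X) :=
  schauder_basis b /\
  forall a : nat -> R, cvgn (series (fun i => a i *: b i)) ->
    forall s : nat -> nat, bijective s ->
      cvgn (series (fun i => a (s i) *: b (s i))).

Definition weakly_null X (x : nat -> X) :=
  forall f : dual X, f (x j) @[j --> \oo] --> (0 : R^o).

Definition normalized_weakly_null X (x : nat -> X) :=
  (forall j, `|x j| = 1) /\ weakly_null x.

Definition seminorm (E : lmodType R) (p : E -> R) :=
  (forall u v, p (u + v) <= p u + p v) /\
  (forall (a : R) u, p (a *: u) = `|a| * p u).

Definition C_equivalent (C : R) (E F : lmodType R) (p : E -> R) (q : F -> R)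
    (n : nat) (x : 'I_n -> E) (y : 'I_n -> F) :=
  forall a : 'I_n -> R,
    C^-1 * q (\sum_(i < n) a i *: y i) <= p (\sum_(i < n) a i *: x i) /\
    p (\sum_(i < n) a i *: x i) <= C * q (\sum_(i < n) a i *: y i).

Definition equivalent_seq (E F : lmodType R) (p : E -> R) (q : F -> R)
    (x : nat -> E) (y : nat -> F) :=
  exists2 C : R, 1 <= C &
    forall n, C_equivalent C p q (fun i : 'I_n => x i) (fun i : 'I_n => y i).

(* Only meaningful on absolutely summable sequences; it is applied below to
   finitely supported ones, where it is the norm of l_1 (see l1_norm_unitE). *)
Definition l1_norm (u : nat -> R^o) : R := limn (series (fun k => `|u k|)).

Definition l1_unit (i : nat) : nat -> R^o := fun k => (k == i)%:R.

Lemma l1_norm_unitE (n : nat) (a : 'I_n -> R) :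
  l1_norm (\sum_(i < n) a i *: l1_unit i) = \sum_(i < n) `|a i|.
Proof.
apply/cvg_lim => //; apply: cvg_near_cst.
exists n => // m /= nm.
rewrite fct_sumE /series/= (big_cat_nat (leq0n n) nm)//= big_mkord.
rewrite [X in _ + X]big1_seq ?addr0; last first.
  move=> k /andP[_]; rewrite mem_index_iota => /andP[nk _].
  rewrite big1 ?normr0// => i _.
  change (a i * (k == i)%:R = 0).
  by rewrite gtn_eqF ?mulr0// (leq_trans _ nk).
apply: eq_bigr => k _; congr `|_|; rewrite (bigD1 k)//= big1.
  change (a k * (val k == val k)%:R + 0 = a k).
  by rewrite eqxx mulr1 addr0.
move=> i ik; change (a i * (val k == val i)%:R = 0).
by rewrite eq_sym val_eqE (negbTE ik) mulr0.
Qed.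

(* x i is the i-th sequence of the array. *)
Definition generates_asymptotic_model X (x : nat -> nat -> X)
    (E : lmodType R) (p : E -> R) (e : nat -> E) :=
  forall (eps : R) (n : nat), 0 < eps ->
    exists k0 : nat, forall k : 'I_n -> nat,
      (forall i, (k0 <= k i)%N) ->
      (forall i j : 'I_n, (i < j)%N -> (k i < k j)%N) ->
      forall a : 'I_n -> R, (forall i, -1 <= a i <= 1) ->
        `| `|\sum_(i < n) a i *: x i (k i)| - p (\sum_(i < n) a i *: e i) |
          < eps.

Definition unique_l1_asymptotic_model X :=
  forall x : nat -> nat -> X, (forall i, normalized_weakly_null (x i)) ->
  forall (E : lmodType R) (p : E -> R) (e : nat -> E), seminorm p ->
    generates_asymptotic_model x p e -> equivalent_seq p l1_norm e l1_unit.

(* A strategy of player (S) assigns its next subspace to the list of the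
   vectors already chosen by player (V). *)
Definition winning_strategy X (n : nat) (C : R) (S : seq X -> set X) :=
  (forall h : seq X, finite_codim_subspace (S h)) /\
  forall x : n.-tuple X,
    (forall k : 'I_n, `|tnth x k| = 1 /\ S (take k x) (tnth x k)) ->
    C_equivalent C Num.norm l1_norm (tnth x) (fun i : 'I_n => l1_unit i).

Definition Asymptotic_l1 X :=
  exists2 C : R, 1 <= C &
    forall n : nat, (0 < n)%N -> exists S : seq X -> set X,
      winning_strategy n C S.

End BanachSpaces.

(* Main.v *)
From HB Require Import structures.
Require Import Defs.
From mathcomp Require Import all_boot all_order all_algebra.
From mathcomp Require Import all_classical all_reals all_analysis.
From mathcomp Require Import zify lra.

Set Implicit Arguments.
Unset Strict Implicit.
Unset Printing Implicit Defensive.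

Import Order.TTheory GRing.Theory Num.Theory.
Import numFieldNormedType.Exports.

Local Open Scope classical_set_scope.
Local Open Scope ring_scope.

                                                                               
                                                                          
                                                                         
(** The space is a Tsirelson-type space over a forest on the natural numbers. Its norming set
    [weight] is generated from the unit vectors by taking half the sum of [d] successive members
    supported in [[d, oo)], where no point of an earlier member may be an ancestor of a point of a
    later one. The norm only sees absolute values of coordinates, hence unconditionality.

    Not Asymptotic l_1: on a chain of ancestors at most one summand of an admissible sum lives, so
    every weight has mass at most 1 there ([weight_chain]), and the unit vectors along a chain have
    a sum of norm at most 1. Level [n] contains chains of length [n], and every node has children
    arbitrarily far out. As the unit vectors are weakly null, every finite codimensional subspace
    nearly contains all late ones ([finite_codim_near_basis]). Player (V), who chooses after seeing
    the position, can therefore climb along a chain.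

    Asymptotic models: the array is fixed in advance. A node has at most as many ancestors as its
    level, all on that level, and a counting argument along an ultrafilter ([small_ancestor_hits])
    shows that far out in a row only little norming mass lies on descendants of a given remote
    window. Deleting that mass makes the norming functionals of the chosen vectors jointly
    admissible, and [norm_row_ge] yields the lower l_1 estimate with a uniform constant.

    Reflexivity: [norm_row_ge], applied to blocks of a single vector, shows that tails vanish
    ([tail_to0]). In the other direction, a vector plus a long average of later blocks has norm well
    below 2 ([norm_block_average]), which forces functionals to have vanishing tails
    ([dual_tail_small]). An element of the bidual is then determined by its values on the coordinate
    functionals, and these values form a vector of the space. *)

(** * An infinitely branching forest on the natural numbers *)

Definition parent (s : nat) : nat := logn 2 s.
Definition level (s : nat) : nat := logn 3 s.

(** The exponents of 2 and 3 store the parent and the level. The exponent of 5 is free, so each node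
    has infinitely many children on every level. *)
Definition child (t n m : nat) : nat := (2 ^ t * 3 ^ n * 5 ^ m)%N.

(** The number of steps is cut off at the level, so that the number of ancestors is controlled by
    the level, while level [n] still carries chains of length [n]. Keeping only nodes of the same
    level lets an ancestor reveal the level of its descendants. *)
Definition ancestors (s : nat) : seq nat :=
  [seq t <- [seq iter k.+1 parent s | k <- iota 0 (level s)] | level t == level s].

Lemma parent_child t n m : parent (child t n m) = t.
Proof.
by rewrite /parent /child !lognM ?muln_gt0 ?expn_gt0// !lognX/= !logn_prime//= !muln0 !addn0 muln1.
Qed.

Lemma level_child t n m : level (child t n m) = n.
Proof.
by rewrite /level /child !lognM ?muln_gt0 ?expn_gt0// !lognX/= !logn_prime//= !muln0 !addn0 add0n muln1.
Qed.

Lemma child_gt t n m : (t < child t n m)%N.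
Proof.
rewrite /child (leq_trans (ltn_expl t (isT : (1 < 2)%N)))// -mulnA leq_pmulr//.
by rewrite muln_gt0 !expn_gt0.
Qed.

Lemma child_ge t n m : (m <= child t n m)%N.
Proof.
rewrite /child (leq_trans (ltnW (ltn_expl m (isT : (1 < 5)%N))))// leq_pmull//.
by rewrite muln_gt0 !expn_gt0.
Qed.

Lemma size_ancestors s : (size (ancestors s) <= level s)%N.
Proof. by rewrite size_filter (leq_trans (count_size _ _))// size_map size_iota. Qed.

Lemma level_ancestor s t : t \in ancestors s -> level t = level s.
Proof. by rewrite mem_filter => /andP[/eqP]. Qed.

Lemma mem_ancestors k s : (k < level s)%N -> level (iter k.+1 parent s) = level s ->
  iter k.+1 parent s \in ancestors s.
Proof.
move=> ks e; rewrite mem_filter e eqxx/=; apply/mapP; exists k => //.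
by rewrite mem_iota.
Qed.

(** * The norming set and the normed space *)

Section Weights.
Context {R : realType}.
Implicit Types (w x y : nat -> R) (N : nat).

(** A Tsirelson norming set: the second constructor has the factor 1/2 and the Schreier condition
    that [d] pieces start at [d] or later, with the extra demand that no piece contains an ancestor
    of a point of a later piece. Signs are left to the absolute values in [ev]. *)
Inductive weight : (nat -> R) -> Prop :=
| weight_unit t w : (forall s, w s = (s == t)%:R) -> weight w
| weight_sum d (F : nat -> nat -> R) w :
    (forall i, (i < d)%N -> weight (F i)) ->
    (forall i s, (i < d)%N -> F i s != 0 -> (d <= s)%N) ->
    (forall i j s t, (i < j < d)%N -> F i s != 0 -> F j t != 0 ->
       (s < t)%N /\ s \notin ancestors t) ->
    (forall s, w s = 2^-1 * \sum_(i < d) F i s) -> weight w.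

Lemma weight_ge0 w s : weight w -> 0 <= w s.
Proof.
move=> ww; elim: ww s => [t {}w we s|d F {}w _ IH _ _ we s]; rewrite we//.
by rewrite mulr_ge0// sumr_ge0// => i _; exact: IH.
Qed.

Lemma weight_supp w : weight w -> exists N, forall s, (N <= s)%N -> w s = 0.
Proof.
elim=> [t {}w we|d F {}w _ IH _ _ we].
  by exists t.+1 => s ts; rewrite we gtn_eqF.
have {}IH i : exists N, (i < d)%N -> forall s, (N <= s)%N -> F i s = 0.
  by case: (ltnP i d) => [/IH[N HN]|]; [exists N|exists 0%N].
have [N HN] := choice IH.
exists (\max_(i < d) N i)%N => s Ns; rewrite we big1 ?mulr0// => i _.
by apply: HN => //; rewrite (leq_trans _ Ns)// (leq_bigmax i).
Qed.

Lemma weight0 : weight (fun=> 0).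
Proof.
apply: (@weight_sum 0%N (fun _ _ => 0)) => // [i j s t|s]; first by rewrite andbF.
by rewrite big_ord0 mulr0.
Qed.

Lemma weight_restr (A : pred nat) w : weight w ->
  weight (fun s => (A s)%:R * w s).
Proof.
elim=> [t {}w we|d F {}w _ IH dF sF we].
  have [At|At] := boolP (A t).
    by apply: (@weight_unit t) => s; rewrite we; case: eqVneq => [->|];
      rewrite ?At ?mulr0// mulr1.
  rewrite (_ : (fun _ => _) = (fun=> 0)); first exact: weight0.
  apply/funext => s; rewrite we; case: eqVneq => [->|]; rewrite ?mulr0//.
  by rewrite (negbTE At) mul0r.
apply: (@weight_sum d (fun i s => (A s)%:R * F i s)).
- by [].
- by move=> i s id; rewrite mulf_eq0 negb_or => /andP[_]; exact: dF.
- move=> i j s t id; rewrite !mulf_eq0 !negb_or => /andP[_ ?] /andP[_ ?].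
  exact: (sF i j).
- by move=> s; rewrite we mulrCA mulr_sumr.
Qed.

Lemma sum_successive d (F : nat -> nat -> R) (P : pred nat) :
  (forall i j s t, (i < j < d)%N -> P s -> P t -> F i s != 0 -> F j t != 0 -> False) ->
  exists i0, forall s, P s -> \sum_(i < d) F i s = (i0 < d)%:R * F i0 s.
Proof.
move=> H.
have [[i [id [s [Ps Fis]]]]|no] := pselect
    (exists i, (i < d)%N /\ exists s, P s /\ F i s != 0).
  exists i => t Pt; rewrite id mul1r (bigD1 (Ordinal id))//= big1 ?addr0// => j ji.
  apply/eqP/negPn/negP => Fjt; have : j != i :> nat by [].
  rewrite neq_ltn => /orP[ij|ij].
    by apply: (H j i t s) => //; rewrite ij.
  by apply: (H i j s t) => //; rewrite ij ltn_ord.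
(* The out-of-range index [d] encodes that every summand vanishes on [P]. *)
exists d => s Ps; rewrite ltnn mul0r big1// => i _.
by apply/eqP/negPn/negP => Fis; apply: no; exists i; split => //; exists s.
Qed.

(** Two different pieces of an admissible sum cannot both meet a chain, so the sum restricted to the
    chain is half of a single piece and induction applies. *)
Lemma weight_chain (P : pred nat) w N : weight w ->
  (forall s t, P s -> P t -> (s < t)%N -> s \in ancestors t) ->
  \sum_(t < N) w t * (P t)%:R <= 1.
Proof.
move=> ww HP; elim: ww => [t {}w we|d F {}w wF IH dF sF we].
  apply: (@le_trans _ _ (\sum_(s < N) ((s : nat) == t)%:R)).
    by apply: ler_sum => s _; rewrite we; case: (P s); rewrite ?mulr1 ?mulr0.
  case: (ltnP t N) => tN; last first.
    by rewrite big1// => i _; rewrite ltn_eqF// (leq_trans _ tN).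
  rewrite (bigD1 (Ordinal tN))//= eqxx big1 ?addr0// => i.
  by rewrite -val_eqE /= => /negbTE ->.
have [i0 Hi0] : exists i0, forall s, P s -> \sum_(i < d) F i s = (i0 < d)%:R * F i0 s.
  apply: sum_successive.
  move=> i j s t ijd Ps Pt Fis Fjt; have [st] := sF i j s t ijd Fis Fjt.
  by rewrite HP.
apply: (@le_trans _ _ (2^-1 * ((i0 < d)%:R * \sum_(t < N) F i0 t * (P t)%:R))).
  rewrite !mulr_sumr; apply: ler_sum => s _; rewrite we.
  have [Ps|_] := boolP (P s); last by rewrite !mulr0.
  by rewrite Hi0// !mulr1.
case: (ltnP i0 d) => [id|_]; last by rewrite mul0r mulr0.
by rewrite mul1r; have := IH _ id; lra.
Qed.

Lemma weight_le1 w t : weight w -> w t <= 1.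
Proof.
move=> ww; apply: le_trans (@weight_chain (pred1 t) w t.+1 ww _).
  rewrite (bigD1 (Ordinal (ltnSn t)))//= eqxx mulr1 lerDl sumr_ge0// => i _.
  by rewrite mulr_ge0// weight_ge0.
by move=> s u /eqP -> /eqP ->; rewrite ltnn.
Qed.

Definition ev w x N : R := \sum_(t < N) w t * `|x t|.

Lemma ev_ge0 w x N : weight w -> 0 <= ev w x N.
Proof. by move=> ww; apply: sumr_ge0 => t _; rewrite mulr_ge0// weight_ge0. Qed.

Lemma ev_le w x y N : weight w -> (forall t, `|x t| <= `|y t|) ->
  ev w x N <= ev w y N.
Proof.
by move=> ww xy; apply: ler_sum => t _; rewrite ler_wpM2l// weight_ge0.
Qed.

Lemma evD w x y N : weight w ->
  ev w (fun t => x t + y t) N <= ev w x N + ev w y N.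
Proof.
move=> ww; rewrite -big_split/=; apply: ler_sum => t _.
by rewrite -mulrDr ler_wpM2l ?weight_ge0// ler_normD.
Qed.

Lemma evZ w a x N : ev w (fun t => a * x t) N = `|a| * ev w x N.
Proof. by rewrite mulr_sumr; apply: eq_bigr => t _; rewrite normrM mulrCA. Qed.

Lemma ev_supp w x N M : (forall s, (N <= s)%N -> w s = 0) -> (N <= M)%N ->
  ev w x M = ev w x N.
Proof.
move=> wN NM; rewrite /ev -!(big_mkord xpredT (fun t => w t * `|x t|)).
rewrite (big_cat_nat (leq0n N) NM)//= [X in _ + X]big1_seq ?addr0//.
by move=> t /andP[_]; rewrite mem_index_iota => /andP[Nt _]; rewrite wN ?mul0r.
Qed.

Definition tree_bounded : {pred nat -> R^o} :=
  fun x => `[< exists M : R, forall w N, weight w -> ev w x N <= M >].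

Record tree_space := TreeSpace {
  tree_fun :> nat -> R^o ;
  tree_funP : tree_fun \in tree_bounded }.

HB.instance Definition _ := [isSub for tree_fun].
HB.instance Definition _ := gen_eqMixin tree_space.
HB.instance Definition _ := gen_choiceMixin tree_space.

Lemma tree_bounded_submod_closed : submod_closed tree_bounded.
Proof.
split.
  apply/asboolP; exists 0 => w N _; rewrite /ev big1// => t _.
  by rewrite normr0 mulr0.
move=> a x y /asboolP[M HM] /asboolP[M' HM']; apply/asboolP.
exists (`|a| * M + M') => w N ww.
apply: (le_trans (@evD w (fun t => a * x t) y N ww)).
by rewrite evZ lerD ?ler_wpM2l ?HM ?HM'.
Qed.

HB.instance Definition _ := GRing.isSubmodClosed.Build R (nat -> R^o)
  tree_bounded tree_bounded_submod_closed.
HB.instance Definition _ := [SubChoice_isSubLmodule of tree_space by <:].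

Implicit Types X Y : tree_space.

Definition tree_norm X : R :=
  sup [set r | exists w N, weight w /\ r = ev w X N].

Lemma tree_norm_has_sup X :
  has_sup [set r | exists w N, weight w /\ r = ev w X N].
Proof.
split; first by exists (ev (fun=> 0) X 0), (fun=> 0), 0%N; split => //; exact: weight0.
by have /asboolP[M HM] := tree_funP X; exists M => _ [w [N [ww ->]]]; exact: HM.
Qed.

Lemma tree_norm_ub X w N : weight w -> ev w X N <= tree_norm X.
Proof.
by move=> ww; apply: sup_upper_bound (tree_norm_has_sup X) _ _; exists w, N.
Qed.

Lemma tree_norm_le X M : (forall w N, weight w -> ev w X N <= M) -> tree_norm X <= M.
Proof.
move=> H; apply: ge_sup; first by case: (tree_norm_has_sup X).
by move=> _ [w [N [ww ->]]]; exact: H.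
Qed.

Lemma tree_normD X Y : tree_norm (X + Y) <= tree_norm X + tree_norm Y.
Proof.
apply: tree_norm_le => w N ww; apply: (le_trans (@evD w X Y N ww)).
by rewrite lerD// tree_norm_ub.
Qed.

Lemma tree_norm_ge0 X : 0 <= tree_norm X.
Proof.
apply: le_trans (@tree_norm_ub X (fun=> 0) 0 weight0); exact: ev_ge0 weight0.
Qed.

Lemma tree_normZ_le a X : tree_norm (a *: X) <= `|a| * tree_norm X.
Proof.
apply: tree_norm_le => w N ww; rewrite (evZ w a X N).
by rewrite ler_wpM2l// tree_norm_ub.
Qed.

Lemma tree_normZ a X : tree_norm (a *: X) = `|a| * tree_norm X.
Proof.
apply/eqP; rewrite eq_le tree_normZ_le/=.
have [->|a0] := eqVneq a 0; first by rewrite normr0 mul0r tree_norm_ge0.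
rewrite -ler_pdivlMl ?normr_gt0// -normfV.
by rewrite -{1}[X](scalerK a0) tree_normZ_le.
Qed.

Lemma tree_norm_coord X t : `|X t| <= tree_norm X.
Proof.
have wt : weight (fun s => (s == t)%:R) by exact: weight_unit.
apply: le_trans (@tree_norm_ub X _ t.+1 wt).
by rewrite /ev (bigD1 (Ordinal (ltnSn t)))//= eqxx mul1r lerDl sumr_ge0.
Qed.

Lemma tree_norm0_eq0 X : tree_norm X = 0 -> X = 0.
Proof.
move=> X0; apply/val_inj/funext => t /=; apply/eqP.
by rewrite -normr_le0 -X0 tree_norm_coord.
Qed.

HB.instance Definition _ := Lmodule_isNormed.Build R tree_space
  tree_normD tree_normZ tree_norm0_eq0.

End Weights.
Arguments tree_space R : clear implicits.

(** * Norm estimates, completeness, restrictions and unit vectors *)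

Section Space.
Context {R : realType}.
Local Notation X := (tree_space R).
Implicit Types (x y : X) (w : nat -> R).

Lemma norm_ub x w N : weight w -> ev w x N <= `|x|.
Proof. exact: tree_norm_ub. Qed.

Lemma norm_le x (M : R) : (forall w N, weight w -> ev w x N <= M) -> `|x| <= M.
Proof. exact: tree_norm_le. Qed.

Lemma norm_coord x t : `|x t| <= `|x|.
Proof. exact: tree_norm_coord. Qed.

Lemma norm_near x (e : R) : 0 < e -> exists w N, weight w /\ `|x| - e < ev w x N.
Proof.
move=> e0; have [_ [w [N [ww ->]]] h] := sup_adherent e0 (tree_norm_has_sup x).
by exists w, N.
Qed.

Lemma norm_solid x y : (forall t, `|x t| <= `|y t|) -> `|x| <= `|y|.
Proof.
move=> xy; apply: norm_le => w N ww.
by apply: le_trans (ev_le N ww xy) (norm_ub _ _ ww).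
Qed.

Lemma tree_fun_bounded (f : nat -> R) (M : R) :
  (forall w N, weight w -> ev w f N <= M) -> exists x : X, tree_fun x = f.
Proof.
move=> H; have f_ : f \in tree_bounded (R := R) by apply/asboolP; exists M.
by exists (TreeSpace f_).
Qed.
End Space.

Section Space2.
Context {R : realType}.
Local Notation X := (tree_space R).
Implicit Types (x y : X) (w : nat -> R).

(** The limit is taken coordinatewise. Each [ev w _ N] involves finitely many coordinates, so a
    uniform bound along the filter survives in the limit, and only afterwards is the supremum over
    weights taken. *)
Lemma tree_space_complete (F : set_system X) : ProperFilter F -> cauchy F -> cvg F.
Proof.
move=> PF cF.
have coord t : cvg ((fun x : X => x t : R^o) @ F).
  apply: cauchy_cvg; apply: cauchy_exP => e e0.
  have [x Fx] := (cauchyP F).1 cF e e0.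
  exists (x t); apply: (@filterS _ F _ (ball x e)) Fx => y.
  rewrite -!ball_normE /= => xy.
  by apply: le_lt_trans xy; exact: (norm_coord (x - y) t).
pose y t : R^o := lim ((fun x : X => x t : R^o) @ F).
have close e : 0 < e -> exists x0 : X, F (ball x0 e) /\
    forall w N, weight w -> ev w (fun t => y t - x0 t) N <= e.
  move=> e0; have [x0 Fx0] := (cauchyP F).1 cF e e0.
  exists x0; split => // w N ww; apply/ler_addgt0Pr => d d0.
  (* Weights are at most 1, so [N] coordinate errors of this size add up to at most [d]. *)
  have d'0 : 0 < d / N.+1%:R by rewrite divr_gt0.
  have near t : F [set x : X | `|y t - x t| < d / N.+1%:R].
    by have /cvgrPdist_lt/(_ _ d'0) := coord t.
  have [x [/= x0x xy]] := filter_ex (filterI Fx0 (filter_forall _ (fun t : 'I_N => near t))).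
  have -> : (fun t => y t - x0 t) = (fun t => (x - x0) t + (y t - x t)).
    apply/funext => t; change (y t - x0 t = x t - x0 t + (y t - x t)).
    by rewrite [RHS]addrC subrKA.
  apply: (le_trans (@evD _ w (x - x0) (fun t => y t - x t) N ww)); apply: lerD.
    apply: le_trans (norm_ub (x - x0) N ww) _; move: x0x.
    by rewrite -ball_normE /= distrC => /ltW.
  apply: (@le_trans _ _ (\sum_(t < N) d / N.+1%:R)).
    apply: ler_sum => t _; rewrite -[leRHS]mul1r ler_pM ?weight_ge0 ?weight_le1//.
    exact: ltW.
  rewrite sumr_const card_ord -[_ *+ N]mulr_natl mulrCA ler_piMr ?ltW//.
  by rewrite ltr_pdivrMr// mul1r ltr_nat.
have [x0 [_ Hx0]] := close 1 ltr01.
have [Y YE] : exists Y : X, tree_fun Y = y.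
  apply: (@tree_fun_bounded _ _ (1 + `|x0|)) => w N ww.
  have -> : y = (fun t => (y t - x0 t) + x0 t) by apply/funext => t; rewrite subrK.
  apply: (le_trans (@evD _ w (fun t => y t - x0 t) x0 N ww)).
  by apply: lerD; [exact: Hx0|exact: norm_ub].
apply/cvg_ex; exists Y; apply/cvgrPdist_lt => e e0.
have [x1 [Fx1 Hx1]] := close (e / 2) ltac:(by rewrite divr_gt0).
apply: filterS Fx1 => x; rewrite -ball_normE /= => x1x.
rewrite -(subrK x1 Y) -addrA (le_lt_trans (ler_normD _ _))//.
rewrite [ltRHS](splitr e) ler_ltD//.
by apply: norm_le => w N ww; have := Hx1 w N ww; rewrite -YE.
Qed.

HB.instance Definition _ := Uniform_isComplete.Build (tree_space R) tree_space_complete.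

Lemma restr_subproof (A : pred nat) x :
  (fun t => (A t)%:R * x t : R^o) \in tree_bounded (R := R).
Proof.
apply/asboolP; exists `|x| => w N ww; apply: le_trans (norm_ub x N ww).
apply: ev_le => // t; case: (A t); rewrite ?mul1r// mul0r normr0 //.
Qed.

Definition restr (A : pred nat) x : X := TreeSpace (restr_subproof A x).

Definition tail N x : X := restr (fun t => (N <= t)%N) x.

Lemma basis_subproof t : (fun s => (s == t)%:R : R^o) \in tree_bounded (R := R).
Proof.
apply/asboolP; exists 1 => w N ww.
have := @weight_chain _ (pred1 t) w N ww.
rewrite (eq_bigr (fun s : 'I_N => w s * `|((s : nat) == t)%:R : R|)).
  by apply=> s u /eqP -> /eqP ->; rewrite ltnn.
by move=> s _; rewrite normr_nat.
Qed.

Definition basis t : X := TreeSpace (basis_subproof t).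

Lemma restrE A x t : restr A x t = (A t)%:R * x t. Proof. by []. Qed.
Lemma tailE N x t : tail N x t = (N <= t)%:R * x t. Proof. by []. Qed.
Lemma basisE t s : basis t s = (s == t)%:R. Proof. by []. Qed.
Lemma tree_addE x y t : (x + y) t = x t + y t. Proof. by []. Qed.
Lemma tree_oppE x t : (- x) t = - x t. Proof. by []. Qed.
Lemma tree_scaleE (a : R) x t : (a *: x) t = a * x t. Proof. by []. Qed.
Lemma tree_zeroE t : (0 : X) t = 0. Proof. by []. Qed.

Lemma tree_sumE (I : Type) (r : seq I) (P : pred I) (f : I -> X) t :
  (\sum_(i <- r | P i) f i) t = \sum_(i <- r | P i) f i t.
Proof. exact: (big_morph (fun x : X => x t)). Qed.

Lemma tree_eq x y : (forall t, x t = y t) -> x = y.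
Proof. by move=> xy; apply/val_inj/funext. Qed.

Lemma norm_restr A x : `|restr A x| <= `|x|.
Proof.
apply: norm_solid => t; rewrite restrE; case: (A t); rewrite ?mul1r// mul0r normr0//.
Qed.

Lemma basis_norm t : `|basis t| = 1.
Proof.
apply/eqP; rewrite eq_le; apply/andP; split.
  apply: norm_le => w N ww; have := @weight_chain _ (pred1 t) w N ww.
  rewrite (eq_bigr (fun s : 'I_N => w s * `|basis t s|)).
    by apply=> s u /eqP -> /eqP ->; rewrite ltnn.
  by move=> s _; rewrite normr_nat.
by have := norm_coord (basis t) t; rewrite basisE eqxx normr1.
Qed.

Lemma norm_finite_le x N (c : R) : (forall t, (N <= t)%N -> x t = 0) ->
  (forall t, `|x t| <= c) -> `|x| <= N%:R * c.
Proof.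
move=> xN xc; have c0 : 0 <= c by apply: le_trans (xc 0%N).
apply: norm_le => w M ww.
apply: (@le_trans _ _ (\sum_(t < M) (t < N)%:R * c)).
  apply: ler_sum => t _; case: ltnP => tN; last by rewrite xN// normr0 mulr0 mul0r.
  by rewrite ler_pM ?weight_ge0 ?weight_le1.
rewrite -mulr_suml ler_wpM2r// -natr_sum ler_nat.
elim: M => [|M IH]; first by rewrite big_ord0.
rewrite big_ord_recr/=; case: ltnP => MN; last by rewrite addn0.
rewrite addn1 (leq_trans _ MN)// ltnS.
by rewrite -[leqRHS]card_ord -sum1_card leq_sum// => i _; case: ltnP.
Qed.

End Space2.

(** * The lower l_1 estimate for coordinatewise null arrays *)

Section Key.
Context {R : realType}.
Local Notation X := (tree_space R).

(** The intervals [[a l, b l)] are successive, so each member of [s] is counted for at most one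
    [l]. *)
Lemma sum_has_intervals (a b : nat -> nat) (L : nat) (s : seq nat) :
  (forall l, (b l <= a l.+1)%N) -> (forall l, (a l <= a l.+1)%N) ->
  (\sum_(l < L) has (fun c => a l <= c < b l) s <= size s)%N.
Proof.
move=> ba aa; elim: s => [|c s IH].
  by rewrite big1.
apply: (@leq_trans (\sum_(l < L) (a l <= c < b l) +
    \sum_(l < L) has (fun c => a l <= c < b l) s)%N).
  by rewrite -big_split/=; apply: leq_sum => l _; case: (_ <= c < _)%N; case: has.
rewrite /= -[(size s).+1]add1n leq_add//.
apply: (@leq_trans (c < a L)%N); last by case: (c < _)%N.
elim: {IH s} L => [|L IH]; first by rewrite big_ord0.
rewrite big_ord_recr/=; move: IH; set n := (\sum_(_ < _) _)%N.
have := ba L; have := aa L; case: (ltnP c (a L)) => [h|h].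
  move=> h1 _ n1; rewrite addn0 (leq_trans n1)//.
  by rewrite (leq_trans h h1).
move=> _ h2; rewrite leqn0 => /eqP ->; rewrite add0n /=.
by case: (ltnP c (b L)) => // h3; rewrite (leq_trans h3 h2).
Qed.

                                                                      
                                                                     
(** If it failed, there would be successive intervals, as many as desired, each hit with mass above
    [e] for [U]-most [j]. One [j] serves finitely many of them at once; since [A t] meets at most
    [c] of these intervals and the total mass is at most 1, their number times [e] is at most
    [c]. *)
Lemma small_interval_hits (U : set_system nat) (m : nat -> nat -> R)
    (K : nat -> nat) (A : nat -> seq nat) (c : nat) (e : R) :
  UltraFilter U -> 0 < e -> (forall j t, 0 <= m j t) ->
  (forall j, \sum_(t < K j) m j t <= 1) -> (forall s, (size (A s) <= c)%N) ->
  exists N, forall M, U [set j | \sum_(t < K j)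
    m j t * (has (fun a => N <= a < M)%N (A t))%:R <= e].
Proof.
move=> UU e0 m0 m1 Ac; apply: contrapT => no.
have /choice[f Hf] : forall N, exists M, U [set j | e <
    \sum_(t < K j) m j t * (has (fun a => N <= a < M)%N (A t))%:R].
  move=> N; apply: contrapT => no'; apply: no; exists N => M.
  set B := [set _ | _]; have [//|UB] := in_ultra_setVsetC B UU.
  exfalso; apply: no'; exists M; apply: filterS UB => j /negP.
  by rewrite -ltNge.
pose a := fix a l := if l is l'.+1 then maxn (a l') (f (a l')) else 0%N.
pose L := (Num.truncn (c%:R / e)).+1.
have [j Hj] := filter_ex (filter_forall _ (fun l : 'I_L => Hf (a l))).
have : \sum_(l < L) e <= c%:R.
  apply: (@le_trans _ _ (\sum_(l < L) \sum_(t < K j)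
     m j t * (has (fun b => a l <= b < f (a l))%N (A t))%:R)).
    by apply: ler_sum => l _; apply: ltW; exact: Hj.
  rewrite exchange_big/=.
  apply: (@le_trans _ _ (\sum_(t < K j) m j t * c%:R)).
    apply: ler_sum => t _; rewrite -mulr_sumr ler_wpM2l// -natr_sum ler_nat.
    apply: leq_trans (Ac t); apply: (sum_has_intervals (b := fun l => f (a l))) => l.
      exact: leq_maxr.
    exact: leq_maxl.
  by rewrite -mulr_suml ler_piMl.
rewrite sumr_const card_ord -[_ *+ L]mulr_natl -ler_pdivlMr// leNgt.
by rewrite truncnS_gt.
Qed.

(** The number of ancestors is bounded only on bounded levels, so [small_interval_hits] is used
    twice: once for the level itself, to make the mass on finitely many high levels small, and once
    for the ancestors of nodes on low levels. *)
Lemma small_ancestor_hits (U : set_system nat) (m : nat -> nat -> R)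
    (K : nat -> nat) (e : R) :
  UltraFilter U -> 0 < e -> (forall j t, 0 <= m j t) ->
  (forall j, \sum_(t < K j) m j t <= 1) ->
  exists N, forall M, U [set j | \sum_(t < K j)
    m j t * (has (fun a => N <= a < M)%N (ancestors t))%:R <= e].
Proof.
move=> UU e0 m0 m1; have e20 : 0 < e / 2 by rewrite divr_gt0.
have [N0 HN0] := @small_interval_hits U m K (fun t => [:: level t]) 1 (e / 2)
  UU e20 m0 m1 (fun=> leqnn 1).
pose A t := if (level t < N0)%N then ancestors t else [::].
have Ac s : (size (A s) <= N0)%N.
  rewrite /A; case: ifP => // sN.
  by rewrite (leq_trans (size_ancestors _))// ltnW.
have [N1 HN1] := @small_interval_hits U m K A N0 (e / 2) UU e20 m0 m1 Ac.
(* An ancestor below [M] has level below [M'], and its descendants share that level. A node that is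
   hit thus has either a low level or a level in [[N0, M')]. *)
exists N1 => M; pose M' := (\max_(t < M) level t).+1.
apply: filterS (filterI (HN0 M') (HN1 M)) => j [/= h0 h1].
rewrite (splitr e) (le_trans _ (lerD h0 h1))// -big_split/=.
apply: ler_sum => t _; rewrite -mulrDr ler_wpM2l// -natrD ler_nat orbF.
case: hasP => // -[s st /andP[N1s sM]].
have [tN|tN] := ltnP (level t) N0.
  rewrite addnC; apply: (@leq_trans (has (fun a => N1 <= a < M)%N (A t))); last exact: leq_addr.
  by rewrite /A tN; case: hasP => // -[]; exists s; rewrite ?N1s.
rewrite -(level_ancestor st) ltnS.
by rewrite (leq_bigmax (Ordinal sM) : (level s <= _)%N).
Qed.

(** A gliding hump. Norming weights of the chosen vectors are cut to disjoint windows and freed of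
    nodes with ancestors in earlier windows; half their sum is again a weight and tests the linear
    combination. One good choice of positions beyond [k0] suffices, since an asymptotic model
    controls all late choices. *)
Lemma norm_row_ge (x : nat -> nat -> X) (delta : R) : 0 < delta ->
  (forall i j, exists w N, weight w /\ delta <= ev w (x i j) N) ->
  (forall i j, `|x i j| <= 1) ->
  (forall i t, x i j t @[j --> \oo] --> (0 : R^o)) ->
  (forall i j e, 0 < e -> exists N, forall M, (N <= M)%N -> `|tail M (x i j)| <= e) ->
  forall n k0, exists k : nat -> nat,
    [/\ forall i, (i < n)%N -> (k0 <= k i)%N,
        forall i j, (i < j < n)%N -> (k i < k j)%N &
        forall a : nat -> R,
          delta / 4 * \sum_(i < n) `|a i| <= `|\sum_(i < n) a i *: x i (k i)| ].
Proof.
move=> d0 Hw x1 x0 xtail n k0.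
have /choice[wK HwK] : forall ij : nat * nat, exists wK : (nat -> R) * nat,
    [/\ weight wK.1, delta <= ev wK.1 (x ij.1 ij.2) wK.2 &
      forall s, (wK.2 <= s)%N -> wK.1 s = 0].
  move=> [i j]; have [w [N [ww dN]]] := Hw i j.
  have [N' wN'] := weight_supp ww.
  exists (w, maxn N N'); split => //=; last first.
    by move=> s; rewrite geq_max => /andP[_]; exact: wN'.
  apply: (le_trans dN); rewrite /ev (big_ord_widen _ (fun t => w t * `|x i j t|) (leq_maxl N N')).
  rewrite [leRHS](bigID (fun t : 'I_(maxn N N') => (t < N)%N))/= lerDl sumr_ge0// => t _.
  by rewrite mulr_ge0// weight_ge0.
pose w i j := (wK (i, j)).1; pose K i j := (wK (i, j)).2.
have ww i j : weight (w i j) by have [] := HwK (i, j).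
have wd i j : delta <= ev (w i j) (x i j) (K i j) by have [] := HwK (i, j).
have wK0 i j s : (K i j <= s)%N -> w i j s = 0 by have [_ _] := HwK (i, j); apply.
pose m i j t := w i j t * `|x i j t|.
have m0 i j t : 0 <= m i j t by rewrite mulr_ge0// weight_ge0.
have m1 i j : \sum_(t < K i j) m i j t <= 1.
  exact: le_trans (norm_ub _ (K i j) (ww i j)) (x1 i j).
have [U [UU ooU]] := @ultraFilterLemma nat \oo _.
have PU : ProperFilter U := @ultra_proper _ _ UU.
(* Chosen so that [(n + 2) * e = delta / 2]: each diagonal term loses [2 * e], and the cross terms
   cost [n * e] in total. *)
pose e := delta / (2 * (n.+2)%:R).
have e0 : 0 < e by rewrite divr_gt0// mulr_gt0.
have /choice[thr Hthr] : forall i, exists N, forall M, U [set j | \sum_(t < K i j)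
    m i j t * (has (fun a => N <= a < M)%N (ancestors t))%:R <= e].
  by move=> i; exact: small_ancestor_hits.
(* At least [n], for the Schreier condition on [n] pieces, and past the thresholds of all [n] rows,
   so that hits in [[N0, b)] have small mass. *)
pose N0 := maxn n (\max_(i < n) thr i).
pose hit b t := has (fun a => N0 <= a < b)%N (ancestors t).
(* One step of the induction: from the row [i], the last position [kp] and the cut [b], it produces
   the next position [j] and the next cut [b']. *)
have /choice[f Hf] : forall p : nat * (nat * nat), exists q : nat * nat,
   let i := p.1 in let kp := p.2.1 in let b := p.2.2 in
   let j := q.1 in let b' := q.2 in
   (b <= b')%N /\ ((i < n)%N ->
     [/\ (kp < j)%N, \sum_(t < K i j) m i j t * (hit b t)%:R <= e,
       forall t, (t < b)%N -> `|x i j t| <= e / b.+1%:R,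
       (K i j <= b')%N & forall M, (b' <= M)%N -> `|tail M (x i j)| <= e]).
  move=> [i [kp b]] /=.
  have [i_n|ni] := ltnP i n; last by exists (0%N, b).
  have h1 := ooU _ (nbhs_infty_gt kp); have h2 := Hthr i b.
  have h3 : U [set j | forall t : 'I_b, `|x i j t| <= e / b.+1%:R].
    apply: ooU; refine (@filter_forall nat 'I_b
      (fun t => [set j | `|x i j t| <= e / b.+1%:R]) \oo _ _) => t.
    have /cvgrPdist_le/(_ (e / b.+1%:R)) := x0 i t.
    rewrite divr_gt0// => /(_ isT); apply: filterS => j /=.
    by rewrite sub0r normrN.
  have [j [/= kj [hj cj]]] := filter_ex (filterI h1 (filterI h2 h3)).
  have [Nt HNt] := xtail i j e e0.
  exists (j, maxn b (maxn (K i j) Nt)); split; first exact: leq_maxl.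
  move=> _; split => //=.
  - apply: le_trans hj; apply: ler_sum => t _; rewrite ler_wpM2l// ler_nat.
    rewrite /hit; case: hasP => // -[s st /andP[N0s sb]].
    case: hasP => // -[]; exists s => //; rewrite sb andbT (leq_trans _ N0s)//.
    rewrite leq_max; apply/orP; right.
    exact: (@leq_bigmax _ (fun i : 'I_n => thr i) (Ordinal i_n)).
  - by move=> t tb; exact: (cj (Ordinal tb)).
  - by rewrite !leq_max leqnn orbT.
  - by move=> M; rewrite !geq_max => /andP[_ /andP[_]]; exact: HNt.
pose st := fix st i := if i is i'.+1 then f (i', st i') else (k0, N0).
pose k i := (st i.+1).1; pose b i := (st i).2.
have bS i : (b i <= b i.+1)%N by have [] := Hf (i, st i).
have bmono : {homo b : i j / (i <= j)%N} by apply: homo_leq => //; exact: leq_trans.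
have bN0 i : (N0 <= b i)%N by exact: (bmono 0%N i).
have kS i : (i < n)%N -> ((st i).1 < k i)%N.
  by move=> i_n; have [_ /(_ i_n)[]] := Hf (i, st i).
have khit i : (i < n)%N -> \sum_(t < K i (k i)) m i (k i) t * (hit (b i) t)%:R <= e.
  by move=> i_n; have [_ /(_ i_n)[]] := Hf (i, st i).
have kx i t : (i < n)%N -> (t < b i)%N -> `|x i (k i) t| <= e / (b i).+1%:R.
  by move=> i_n; have [_ /(_ i_n)[_ _ + _ _]] := Hf (i, st i); apply.
have kK i : (i < n)%N -> (K i (k i) <= b i.+1)%N.
  by move=> i_n; have [_ /(_ i_n)[]] := Hf (i, st i).
have ktail i M : (i < n)%N -> (b i.+1 <= M)%N -> `|tail M (x i (k i))| <= e.
  by move=> i_n; have [_ /(_ i_n)[_ _ _ _ +]] := Hf (i, st i); apply.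
have kmono i j : (i < j < n)%N -> (k i < k j)%N.
  move=> /andP[]; elim: j => // j IH; rewrite ltnS leq_eqVlt => /predU1P[-> jn|ij jn].
    exact: kS jn.
  by apply: ltn_trans (kS _ jn); exact: IH ij (ltnW jn).
pose S i : pred nat := fun t => [&& b i <= t, t < b i.+1 & ~~ hit (b i) t]%N.
pose F i t := (S i t)%:R * w i (k i) t.
have FS i t : F i t != 0 -> S i t.
  by rewrite /F; case: (S i t) => //; rewrite mul0r eqxx.
have wF i : weight (F i) by exact: weight_restr.
have wG : weight (fun t => 2^-1 * \sum_(i < n) F i t).
  apply: (@weight_sum _ n F) => //.
    move=> i s _ /FS/and3P[bs _ _]; rewrite (leq_trans _ bs)//.
    by rewrite (leq_trans _ (bN0 i))// leq_maxl.
  move=> i j s t /andP[ij jn] /FS/and3P[bs sb _] /FS/and3P[bt _ nt].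
  have sbj : (s < b j)%N by rewrite (leq_trans sb)// bmono.
  split; first by rewrite (leq_trans sbj).
  apply/negP => st_; move/negP: nt; apply; apply/hasP; exists s => //.
  by rewrite sbj andbT (leq_trans (bN0 i)).
exists k; split => //.
  move=> i i_n; apply: ltnW; elim: i i_n => [|i IH] i_n; first exact: kS i_n.
  exact: ltn_trans (IH (ltnW i_n)) (kS _ i_n).
move=> a; pose z : X := \sum_(i < n) a i *: x i (k i); rewrite -/z.
pose T := b n.
(* Beyond the window the weight vanishes. Mass is lost only on nodes hit by earlier windows and on
   coordinates before [b i], at most [e] each. *)
have Fself i : (i < n)%N -> delta - 2 * e <= ev (F i) (x i (k i)) T.
  move=> i_n.
  have bT : (b i.+1 <= T)%N by exact: bmono.
  rewrite lerBlDr (le_trans (wd i (k i)))//.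
  rewrite -(@ev_supp _ (w i (k i)) (x i (k i)) (K i (k i)) T); last 2 first.
    - exact: wK0.
    - by rewrite (leq_trans _ bT)// kK.
  have h1 : \sum_(t < T) m i (k i) t * (hit (b i) t)%:R <= e.
    apply: le_trans (khit i i_n).
    rewrite -!(big_mkord xpredT (fun t => m i (k i) t * (hit (b i) t)%:R)).
    rewrite (@big_cat_nat _ _ _ (K i (k i)))//=; last by rewrite (leq_trans _ bT)// kK.
    rewrite [X in _ + X]big1_seq ?addr0// => t /andP[_].
    by rewrite mem_index_iota => /andP[Kt _]; rewrite /m wK0// !mul0r.
  have h2 : \sum_(t < T) m i (k i) t * (t < b i)%N%:R <= e.
    pose y : X := restr (fun t => t < b i)%N (x i (k i)).
    have : ev (w i (k i)) y T <= e.
      apply: le_trans (norm_ub _ _ (ww _ _)) _.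
      apply: (@le_trans _ _ ((b i)%:R * (e / (b i).+1%:R))).
        apply: norm_finite_le => t; rewrite restrE; first by rewrite ltnNge => ->; rewrite mul0r.
        case: ltnP => tb; first by rewrite mul1r kx.
        by rewrite mul0r normr0 divr_ge0 ?(ltW e0).
      by rewrite mulrCA ler_piMr ?(ltW e0)// ler_pdivrMr// mul1r ler_nat.
    apply: le_trans; apply: ler_sum => t _; rewrite restrE normrM normr_nat.
    by rewrite /m mulrAC mulrA.
  have -> : 2 * e = e + e by lra.
  rewrite addrA; apply: le_trans (lerD (lerD (lexx _) h1) h2).
  rewrite -!big_split/=; apply: ler_sum => t _; rewrite -/(m i (k i) t) /F /S.
  rewrite -mulrA -/(m i (k i) t) -[_ * m _ _ _]mulrC -!mulrDr.
  have [tb|tb] := ltnP t (b i.+1); last first.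
    by rewrite /m wK0 ?mul0r// (leq_trans _ tb)// kK.
  rewrite -[leLHS]mulr1 ler_wpM2l// -!natrD (ler_nat _ 1) leqNgt.
  by case: (hit (b i) t); case: (leqP (b i) t).
(* A vector chosen later is small before its own cut, and a vector chosen earlier has a small tail
   after its window. *)
have Fother i j : (i < n)%N -> (j < n)%N -> i != j -> ev (F i) (x j (k j)) T <= e.
  move=> i_n jn; rewrite neq_ltn => /orP[ij|ji].
    apply: (@le_trans _ _ (ev (F i) (restr (fun t => t < b j)%N (x j (k j))) T)).
      apply: ler_sum => t _; rewrite restrE normrM normr_nat.
      have [->|/FS/and3P[_ tb _]] := eqVneq (F i t) 0; first by rewrite !mul0r.
      by rewrite (leq_trans tb) ?mul1r// bmono.
    apply: le_trans (norm_ub _ _ (wF _)) _.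
    apply: (@le_trans _ _ ((b j)%:R * (e / (b j).+1%:R))).
      apply: norm_finite_le => t; rewrite restrE; first by rewrite ltnNge => ->; rewrite mul0r.
      case: ltnP => tb; first by rewrite mul1r kx.
      by rewrite mul0r normr0 divr_ge0 ?(ltW e0).
    by rewrite mulrCA ler_piMr ?(ltW e0)// ler_pdivrMr// mul1r ler_nat.
  apply: (@le_trans _ _ (ev (F i) (tail (b i) (x j (k j))) T)).
    apply: ler_sum => t _; rewrite tailE normrM normr_nat.
    have [->|/FS/and3P[-> _ _]] := eqVneq (F i t) 0; first by rewrite !mul0r.
    by rewrite mul1r.
  by apply: le_trans (norm_ub _ _ (wF _)) _; rewrite ktail// bmono.
have F1 i : (i < n)%N ->
    `|a i| * (delta - 2 * e) <= ev (F i) z T + e * \sum_(j < n) `|a j|.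
  move=> i_n; pose i' := Ordinal i_n.
  apply: (@le_trans _ _ (`|a i| * ev (F i) (x i (k i)) T)).
    by rewrite ler_wpM2l// Fself.
  rewrite -evZ.
  apply: (@le_trans _ _ (ev (F i) z T +
     \sum_(j < n | j != i') `|a j| * ev (F i) (x j (k j)) T)).
    under eq_bigr do rewrite -evZ.
    rewrite /ev [X in _ <= _ + X]exchange_big/= -big_split/=.
    apply: ler_sum => t _; rewrite -mulr_sumr -mulrDr ler_wpM2l ?weight_ge0//.
    have -> : z t = a i * x i (k i) t + \sum_(j < n | j != i') a j * x j (k j) t.
      by rewrite /z tree_sumE (bigD1 i').
    set u := a i * _; set v := \sum_(_ < _ | _) _.
    rewrite -[u in leLHS](addrK v) (le_trans (ler_normB _ _))// lerD2l.
    exact: ler_norm_sum.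
  rewrite lerD2l mulr_sumr [leRHS](bigD1 i')//= ler_wpDl ?mulr_ge0 ?(ltW e0) ?(ltW d0)//.
  apply: ler_sum => j ji; rewrite mulrC ler_wpM2r// Fother//.
  by rewrite eq_sym; apply: contraNneq ji => ji; apply/eqP/val_inj.
apply: le_trans (norm_ub z T wG).
have -> : ev (fun t => 2^-1 * \sum_(i < n) F i t) z T = 2^-1 * \sum_(i < n) ev (F i) z T.
  rewrite /ev exchange_big/= mulr_sumr; apply: eq_bigr => t _.
  by rewrite -mulrA mulr_suml.
set A := \sum_(i < n) `|a i|.
have A0 : 0 <= A by exact: sumr_ge0.
have : A * (delta - 2 * e) <= \sum_(i < n) ev (F i) z T + n%:R * (e * A).
  rewrite mulr_suml (_ : n%:R * _ = \sum_(i < n) e * A); last first.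
    by rewrite sumr_const card_ord mulr_natl.
  by rewrite -big_split/=; apply: ler_sum => i _; exact: F1.
have eE : (n%:R + 2) * e = delta / 2.
  by rewrite /e -natrD addn2 invfM [LHS]mulrC -!mulrA mulVf ?mulr1 ?pnatr_eq0.
have -> : n%:R * (e * A) = A * (n%:R * e) by rewrite mulrCA mulrC -mulrA mulrCA.
rewrite -lerBlDr -mulrBr.
have -> : delta - 2 * e - n%:R * e = delta / 2 by move: eE; rewrite mulrDl; lra.
by set Q := \sum_(_ < _) _; lra.
Qed.

End Key.

(** * Bounded functionals *)

Section DualFacts.
Context {R : realType} (V : normedModType R).
Implicit Types (f : dual V) (u v : V).

Lemma dualD f u v : f (u + v) = f u + f v.
Proof. by rewrite -{1}[u]scale1r dualP scale1r. Qed.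

Lemma dualN f u : f (- u) = - f u.
Proof. by rewrite -scaleN1r dualZ scaleN1r. Qed.

Lemma dualB f u v : f (u - v) = f u - f v.
Proof. by rewrite dualD dualN. Qed.

Lemma dual_sumE f (I : Type) (r : seq I) (P : pred I) (F : I -> V) :
  f (\sum_(i <- r | P i) F i) = \sum_(i <- r | P i) f (F i).
Proof. by apply: (big_morph f); [exact: dualD|exact: dual0]. Qed.

Lemma dual_bound f u : `|f u| <= `|f| * `|u|.
Proof.
have [->|u0] := eqVneq u 0; first by rewrite dual0 !normr0 mulr0.
have nu : 0 < `|u| by rewrite normr_gt0.
have := @dual_norm_ub _ _ f (`|u|^-1 *: u).
rewrite normrZ normfV normr_id mulVf ?gt_eqF// => /(_ (lexx _)).
by rewrite dualZ normrZ normfV normr_id ler_pdivrMl// mulrC.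
Qed.

Lemma ex_dual (g : V -> R) (M : R) :
  (forall a u v, g (a *: u + v) = a * g u + g v) ->
  (forall u, `|g u| <= M * `|u|) -> exists f : dual V, forall u, f u = g u.
Proof.
move=> gl gM.
have g_ : (g : V -> R^o) \in @continuous_functional R V; last by exists (Dual g_).
have gB u v : g (u - v) = g u - g v.
  by rewrite addrC -scaleN1r gl mulN1r addrC.
apply/asboolP; split; first by move=> a u v; exact: gl.
move=> u; apply/cvgrPdist_le => e e0.
have M1 : 0 < `|M| + 1 by rewrite ltr_wpDl.
have : \forall v \near u, `|u - v| < e / (`|M| + 1).
  by apply/nbhs_normP; exists (e / (`|M| + 1)) => //=; rewrite divr_gt0.
apply: filterS => v uv; rewrite -gB (le_trans (gM _))//.
apply: (@le_trans _ _ ((`|M| + 1) * `|u - v|)).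
  by rewrite ler_wpM2r// (le_trans (ler_norm M))// lerDl.
by rewrite mulrC -ler_pdivlMr// ltW.
Qed.

End DualFacts.

(** * Tails of vectors and functionals, unconditionality and reflexivity *)

(** The related pairs form a monotone staircase, on which [i + j] is injective with values below
    [r + d]. *)
Lemma staircase_count r d (J : 'I_r -> 'I_d -> bool) :
  (forall i j i' j', J i j -> J i' j' -> (j < j')%N -> (i <= i')%N) ->
  (\sum_(i < r) \sum_(j < d) J i j <= r + d)%N.
Proof.
move=> HJ; rewrite pair_bigA/=.
have h (p : 'I_r * 'I_d) : (p.1 + p.2 < r + d)%N.
  by rewrite -addnS leq_add// ltnW.
pose H p := Ordinal (h p).
rewrite -(card_ord (r + d)) -big_mkcond sum1_card/=.
have inj : {in [pred p : 'I_r * 'I_d | J p.1 p.2] &, injective H}.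
  move=> [i j] [i' j']; rewrite !inE/= => Jij Jij' /(congr1 val)/= e.
  have [jj|jj|jj] := ltngtP j j'.
  - have := HJ _ _ _ _ Jij Jij' jj => ii.
    by have := leq_ltn_trans ii (ltn_addl 0 (ltnSn i')); move: e; lia.
  - have := HJ _ _ _ _ Jij' Jij jj; move: e jj; lia.
  - by congr pair; apply: val_inj => //=; move: e; rewrite jj => /addIn.
by rewrite -(card_in_image inj) max_card.
Qed.

Section Basis.
Context {R : realType}.
Local Notation X := (tree_space R).
Implicit Types (x y : X) (w : nat -> R) (f : dual X).

Lemma norm_tail_le N M x : (N <= M)%N -> `|tail M x| <= `|tail N x|.
Proof.
move=> NM; apply: norm_solid => t; rewrite !tailE.
have [Mt|_] := leqP M t; first by rewrite (leq_trans NM).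
by rewrite mul0r normr0.
Qed.

(** Otherwise [x] contains infinitely many disjoint blocks of norm at least [e]. They form a
    coordinatewise null sequence, so by [norm_row_ge] sums of [n] of them have norm at least
    [n * e / 4]; but such sums are restrictions of [x]. *)
Lemma tail_to0 x e : 0 < e -> exists N, forall M, (N <= M)%N -> `|tail M x| <= e.
Proof.
wlog x1 : x e / `|x| <= 1 => [hw e0|e0].
  have n0 : 0 < `|x| + 1 by rewrite ltr_wpDl.
  have [||N HN] := hw ((`|x| + 1)^-1 *: x) (e / (`|x| + 1)).
  - by rewrite normrZ gtr0_norm ?invr_gt0// mulrC ler_pdivrMr// mul1r lerDl.
  - by rewrite divr_gt0.
  exists N => M NM; have := HN M NM.
  have -> : tail M ((`|x| + 1)^-1 *: x) = (`|x| + 1)^-1 *: tail M x.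
    by apply: tree_eq => t; rewrite tailE !tree_scaleE tailE mulrCA.
  rewrite normrZ gtr0_norm ?invr_gt0// mulrC ler_pM2r// invr_gt0//.
apply: contrapT => no.
have big N : e < `|tail N x|.
  rewrite ltNge; apply/negP => Ne; apply: no; exists N => M NM.
  by apply: le_trans Ne; exact: norm_tail_le.
have /choice[g Hg] : forall N, exists wK : (nat -> R) * nat,
    weight wK.1 /\ e <= ev wK.1 (tail N x) wK.2.
  move=> N; have d0 : 0 < `|tail N x| - e by rewrite subr_gt0.
  have [w [K [ww]]] := norm_near (tail N x) d0; rewrite subKr => /ltW ?.
  by exists (w, K).
pose M := fix M j := if j is j'.+1 then maxn (M j').+1 (g (M j')).2 else 0%N.
have Mlt j : (M j < M j.+1)%N by rewrite /= leq_maxl.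
have Mge j : (j <= M j)%N by elim: j => // j IH; exact: leq_ltn_trans (Mlt j).
have Mmono : {homo M : i j / (i <= j)%N}.
  by apply: homo_leq => //; [exact: leq_trans|move=> j; exact: ltnW].
pose y j := restr (fun t => M j <= t < M j.+1)%N x.
(* All rows are the same block sequence, and the number of terms exceeds [4 / e]. *)
have [||||] := @norm_row_ge R (fun _ => y) e e0 _ _ _ _ (Num.truncn (4 / e)).+1 0%N.
- move=> _ j; have [ww ge_e] := Hg (M j).
  exists (g (M j)).1, (g (M j)).2; split => //; apply: le_trans ge_e _.
  apply: ler_sum => t _; rewrite tailE restrE.
  have -> // : (t < M j.+1)%N by rewrite (leq_trans (ltn_ord t))// leq_maxr.
  by rewrite andbT.
- by move=> _ j; rewrite (le_trans (norm_restr _ _)).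
- move=> _ t; apply: cvg_near_cst; exists t.+1 => // j /= tj.
  by rewrite [(M j <= t)%N]leqNgt (leq_trans tj (Mge j)) mul0r.
- move=> _ j d d0; exists (M j.+1) => N MN.
  rewrite (_ : tail N (y j) = 0) ?normr0 ?ltW//.
  apply: tree_eq => t; rewrite tailE restrE tree_zeroE.
  have [Nt|_] := leqP N t; last by rewrite mul0r.
  by rewrite [(t < _)%N]ltnNge (leq_trans MN Nt) andbF mul0r mulr0.
move=> k [_ kmono /(_ (fun=> 1))]; set n := (_).+1 in kmono *.
suff z1 : `|\sum_(i < n) 1 *: y (k i)| <= 1.
  move=> /le_trans/(_ z1); rewrite sumr_const normr1 card_ord.
  rewrite -mulr_natl mulr1 mulrC -ler_pdivlMr ?divr_gt0//.
  by rewrite mul1r invf_div leNgt truncnS_gt.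
apply: le_trans x1; apply: norm_solid => t; rewrite tree_sumE.
have [i0 Hi0] : exists i0, forall s, pred1 t s ->
    \sum_(i < n) y (k i) s = (i0 < n)%:R * y (k i0) s.
  apply: (@sum_successive _ _ (fun i s => y (k i) s)) => i j s u ijn /eqP -> /eqP ->.
  rewrite !restrE => + tj.
  have {tj} : (M (k j) <= t)%N by move: tj; case: (leqP (M (k j)) t) => // _; rewrite /= mul0r eqxx.
  move=> tj; have Mt : (M (k i).+1 <= t)%N.
    by apply: leq_trans tj; apply: Mmono; exact: kmono.
  by rewrite [(t < _)%N]ltnNge Mt andbF mul0r eqxx.
under eq_bigr do rewrite scale1r.
rewrite Hi0 ?inE// restrE; case: (_ < _)%N; case: (_ <= _ < _)%N;
  by rewrite ?mul1r ?mul0r ?mulr0 ?normr0.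
Qed.

Lemma sum_basis (a : nat -> R) n t :
  (\sum_(i < n) a i *: (basis i : X)) t = (t < n)%:R * a t.
Proof.
rewrite tree_sumE; under eq_bigr do rewrite tree_scaleE basisE.
have [tn|nt] := ltnP t n; last first.
  rewrite mul0r big1// => i _; rewrite gtn_eqF ?mulr0//.
  exact: leq_trans nt.
rewrite (bigD1 (Ordinal tn))//= eqxx mulr1 mul1r big1 ?addr0// => i it.
by rewrite eq_sym (negbTE (it : (i : nat) != t)) mulr0.
Qed.

Lemma sub_tail x n : x - tail n x = \sum_(i < n) x i *: basis i.
Proof.
apply: tree_eq => t; rewrite sum_basis tree_addE tree_oppE tailE.
by case: ltnP; rewrite ?mul1r ?mul0r ?subr0 ?subrr.
Qed.

Lemma seriesE (a : nat -> R) n :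
  series (fun i => a i *: (basis i : X)) n = \sum_(i < n) a i *: basis i.
Proof. by rewrite /series/= big_mkord. Qed.

Lemma cvg_basis x : series (fun i => x i *: basis i) @ \oo --> x.
Proof.
apply/cvgrPdist_le => e e0; have [N HN] := tail_to0 x e0.
exists N => // n /= Nn; rewrite seriesE -sub_tail opprB addrC subrK.
exact: HN.
Qed.

Lemma basis_coeff (a : nat -> R) x :
  series (fun i => a i *: basis i) @ \oo --> x -> a = x :> (nat -> R).
Proof.
move=> ax; apply/funext => t; apply/eqP; rewrite eq_sym -subr_eq0 -normr_le0.
apply/ler_addgt0Pr => e e0; rewrite add0r.
have /cvgrPdist_le/(_ e e0)[N _ HN] := ax.
have := HN (maxn N t.+1) (leq_maxl _ _); apply: le_trans; rewrite seriesE.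
have := norm_coord (x - \sum_(i < maxn N t.+1) a i *: basis i) t.
by rewrite tree_addE tree_oppE sum_basis leq_max ltnSn orbT mul1r.
Qed.

Lemma basis_unconditional : unconditional_basis (basis : nat -> X).
Proof.
split=> [x|a /cvg_ex[x ax] s [s' sK s'K]].
  by exists x; split; [exact: cvg_basis|move=> a /basis_coeff].
rewrite (basis_coeff ax); apply/cvg_ex; exists x.
apply/cvgrPdist_le => e e0; have [N HN] := tail_to0 x e0.
exists (\max_(t < N) s' t).+1 => // n /= Nn.
rewrite /series/= big_mkord; apply: le_trans (HN N (leqnn N)).
apply: norm_solid => t; rewrite tree_addE tree_oppE tree_sumE tailE.
have -> : \sum_(i < n) (x (s i) *: (basis (s i) : X)) t = (s' t < n)%:R * x t.
  under eq_bigr do rewrite tree_scaleE basisE.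
  have [tn|nt] := ltnP (s' t) n; last first.
    rewrite mul0r big1// => i _; case: eqVneq => [ts|]; rewrite ?mulr0//.
    by move: nt; rewrite ts sK leqNgt ltn_ord.
  rewrite (bigD1 (Ordinal tn))//= s'K eqxx mulr1 mul1r big1 ?addr0// => i it.
  case: eqVneq => [ts|]; rewrite ?mulr0//.
  by case/eqP: it; apply: val_inj; rewrite /= ts sK.
have [Nt|tN] := leqP N t.
  by case: (_ < _)%N; rewrite !mul1r ?mul0r ?subr0// subrr normr0.
have -> : (s' t < n)%N.
  by rewrite (leq_trans _ Nn)// ltnS (leq_bigmax (Ordinal tN)).
by rewrite mul1r subrr normr0.
Qed.

(** A weight missing [[0, m0)] ignores [x] and gives at most 1 on the average. A weight meeting it
    is a unit vector, which ignores the [y i], or has at most [m0] pieces; the factor 1/2 then acts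
    on the average, up to an error from blocks met by several pieces. *)
Lemma norm_block_average (m0 r : nat) (M : nat -> nat) x (y : nat -> X) :
  (0 < r)%N -> (m0 <= M 0%N)%N -> {homo M : i j / (i <= j)%N} ->
  (forall t, (m0 <= t)%N -> x t = 0) -> `|x| <= 1 ->
  (forall i t, y i t != 0 -> (M i <= t < M i.+1)%N) -> (forall i, `|y i| <= 1) ->
  `|x + r%:R^-1 *: \sum_(i < r) y i| <= 3 / 2 + m0%:R / r%:R.
Proof.
move=> r0 mM Mmono xm x1 yM y1; have r0' : 0 < r%:R :> R by rewrite ltr0n.
have m0r : 0 <= m0%:R / r%:R :> R by rewrite divr_ge0.
apply: norm_le => w K ww.
have wsum : ev w (x + r%:R^-1 *: \sum_(i < r) y i) K <=
    ev w x K + r%:R^-1 * \sum_(i < r) ev w (y i) K.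
  apply: (le_trans (@evD _ w x (r%:R^-1 *: \sum_(i < r) y i) K ww)).
  rewrite lerD2l (evZ w r%:R^-1 (\sum_(i < r) y i)) gtr0_norm ?invr_gt0//.
  rewrite ler_wpM2l ?invr_ge0// /ev exchange_big/=.
  apply: ler_sum => t _; rewrite -mulr_sumr ler_wpM2l ?weight_ge0// tree_sumE.
  exact: ler_norm_sum.
apply: (le_trans wsum).
have wx1 : ev w x K <= 1 by apply: le_trans (norm_ub _ _ ww) x1.
have wy1 v i : weight v -> ev v (y i) K <= 1.
  by move=> wv; apply: le_trans (norm_ub _ _ wv) (y1 i).
have [[t0 [t0m wt0]]|no] := pselect (exists t, (t < m0)%N /\ w t != 0); last first.
  have -> : ev w x K = 0.
    rewrite /ev big1// => t _; have [tm|mt] := ltnP t m0; last by rewrite xm// normr0 mulr0.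
    have [->|wt] := eqVneq (w t) 0; first by rewrite mul0r.
    by exfalso; apply: no; exists t.
  have : r%:R^-1 * \sum_(i < r) ev w (y i) K <= 1.
    rewrite ler_pdivrMl// mulr1 -[leRHS]mulr1 -[r in leRHS]card_ord.
    by rewrite mulr_natl -sumr_const ler_sum// => i _; exact: wy1.
  lra.
case: ww wt0 wx1 {wsum} => [t {}w we|d F {}w wF dF sF we] wt0 wx1.
  rewrite [X in _ * X]big1 ?mulr0 ?addr0; first by lra.
  move=> i _; rewrite /ev big1// => s _; rewrite we.
  case: eqVneq => [st|]; last by rewrite mul0r.
  have [->|/yM/andP[Ms _]] := eqVneq (y i s) 0; first by rewrite normr0 mulr0.
  move: wt0; rewrite we; have [tt|_] := eqVneq t0 t; last by rewrite eqxx.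
  have : (m0 <= s)%N by rewrite (leq_trans mM)// (leq_trans _ Ms)// Mmono.
  by rewrite st -tt leqNgt t0m.
(* Some piece contains [t0 < m0], and all pieces start at [d] or later. *)
have dm : (d <= m0)%N.
  apply: contraT; rewrite -ltnNge => md.
  move: wt0; rewrite we big1 ?mulr0 ?eqxx// => j _.
  apply/eqP; apply: contraT => /(dF _ _ (ltn_ord j)).
  by rewrite leqNgt (ltn_trans t0m md).
(* Pieces and blocks are both successive, so their incidences form a staircase with at most [r + d]
   pairs, each worth at most 1. *)
pose J (i : 'I_r) (j : 'I_d) : bool := `[< exists s, F j s != 0 /\ y i s != 0 >].
have JF (i : 'I_r) (j : 'I_d) : ev (F j) (y i) K <= (J i j)%:R.
  rewrite /J; case: asboolP => [_|nJ]; first by apply: wy1; exact: wF.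
  rewrite /ev big1// => s _; have [->|Fs] := eqVneq (F j s) 0; first by rewrite mul0r.
  have [->|ys] := eqVneq (y i s) 0; first by rewrite normr0 mulr0.
  by exfalso; apply: nJ; exists s.
have : (\sum_(i < r) \sum_(j < d) J i j <= r + d)%N.
  apply: staircase_count => i j i' j' /asboolP[s [Fs ys]] /asboolP[s' [Fs' ys']] jj.
  have [ss _] : (s < s')%N /\ s \notin ancestors s'.
    by apply: (sF j j') => //; rewrite jj ltn_ord.
  have /andP[Ms _] := yM _ _ ys; have /andP[_ Ms'] := yM _ _ ys'.
  rewrite leqNgt; apply/negP => ii.
  have := leq_trans (leq_ltn_trans Ms ss) (ltnW Ms').
  by rewrite ltnNge Mmono.
rewrite -(ler_nat R) natrD => hJ.
have hw : \sum_(i < r) ev w (y i) K <= 2^-1 * (r%:R + m0%:R).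
  apply: (@le_trans _ _ (\sum_(i < r) 2^-1 * \sum_(j < d) ev (F j) (y i) K)).
    apply: ler_sum => i _; rewrite /ev exchange_big/= mulr_sumr.
    by apply: ler_sum => t _; rewrite we -mulrA mulr_suml.
  rewrite -mulr_sumr ler_pM2l ?invr_gt0//.
  apply: (@le_trans _ _ (r%:R + d%:R)); last by rewrite lerD2l ler_nat.
  apply: le_trans hJ; rewrite natr_sum; apply: ler_sum => i _.
  by rewrite natr_sum; apply: ler_sum => j _; exact: JF.
have : r%:R^-1 * \sum_(i < r) ev w (y i) K <= 2^-1 * (1 + m0%:R / r%:R).
  rewrite ler_pdivrMl//; apply: le_trans hw _.
  by rewrite [leRHS]mulrCA ler_pM2l ?invr_gt0// [leRHS]mulrDr mulr1 [_ * (_ / _)]mulrC divfK ?gt_eqF.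
move: m0r wx1; set q := m0%:R / r%:R; set u := ev w x K; set v := _^-1 * \sum_(_ < _) _.
by lra.
Qed.

(** Otherwise [f] exceeds about [9/10 * c] on norm-one blocks arbitrarily far out. For one such
    block plus a long average of later ones, [f] is at least [9/5 * c], whereas the norm is at most
    [8/5], so that [f] is at most [8/5 * c]. *)
Lemma dual_tail_contract f (c : R) : 0 < c ->
  (exists N, forall x, (forall t, (t < N)%N -> x t = 0) -> `|f x| <= c * `|x|) ->
  exists N, forall x, (forall t, (t < N)%N -> x t = 0) -> `|f x| <= 9 / 10 * c * `|x|.
Proof.
move=> c0 [Nc HNc]; apply: contrapT => no.
have /choice[g Hg] : forall N, exists q : X * nat,
    [/\ forall t, (t < N)%N -> q.1 t = 0, forall t, (q.2 <= t)%N -> q.1 t = 0,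
        `|q.1| <= 1 & 9 / 10 * c <= f q.1].
  move=> N; have [x xN fx] : exists2 x : X, (forall t, (t < N)%N -> x t = 0) &
      9 / 10 * c * `|x| < `|f x|.
    apply: contrapT => no'; apply: no; exists N => x xN.
    by rewrite leNgt; apply/negP => fx; apply: no'; exists x.
  have x0 : 0 < `|x|.
    rewrite normr_gt0; apply/eqP => x0; move: fx.
    by rewrite x0 dual0 !normr0 mulr0 ltxx.
  pose z : X := (Num.sg (f x) / `|x|) *: x.
  have zN t : (t < N)%N -> z t = 0 by move=> tN; rewrite tree_scaleE xN ?mulr0.
  have z1 : `|z| <= 1.
    rewrite normrZ normrM normfV normr_id -mulrA mulVf ?gt_eqF// mulr1.
    by rewrite normr_sg; case: (_ == _).
  have fz : 9 / 10 * c < f z.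
    rewrite dualZ -[_ *: _]/(_ * _) [ltRHS]mulrAC -normrEsg.
    by rewrite ltr_pdivlMr.
  have f1 : 0 < `|f| + 1 by rewrite ltr_wpDl.
  (* The strict excess of [f z] over [9/10 * c] pays for truncating [z] to a finitely supported
     vector. *)
  have h0 : 0 < (f z - 9 / 10 * c) / (`|f| + 1) by rewrite divr_gt0 ?subr_gt0.
  have [M HM] := tail_to0 z h0.
  have [u uz uE] : exists2 u : X, u = z - tail M z &
      forall t, u t = z t - (M <= t)%:R * z t by exists (z - tail M z).
  exists (u, M) => /=; split.
  - by move=> t tN; rewrite uE zN// mulr0 subr0.
  - by move=> t Mt; rewrite uE Mt mul1r subrr.
  - apply: le_trans z1; apply: norm_solid => t; rewrite uE.
    by case: (_ <= _)%N; rewrite ?mul1r ?mul0r ?subrr ?subr0// normr0.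
  rewrite uz dualB lerBrDr -lerBrDl; apply: le_trans (ler_norm _) _.
  apply: le_trans (dual_bound _ _) _.
  apply: (@le_trans _ _ ((`|f| + 1) * `|tail M z|)); first by rewrite ler_wpM2r// lerDl.
  by rewrite mulrC -ler_pdivlMr// HM.
pose x := (g Nc).1; pose m0 := (g Nc).2.
have [xN xm x1 fx] := Hg Nc; rewrite -/x -/m0 in xN xm x1 fx.
pose M := fix M j := if j is j'.+1 then maxn (M j') (g (M j')).2 else maxn Nc m0.
pose y i := (g (M i)).1.
have MS j : (M j <= M j.+1)%N by rewrite /= leq_maxl.
have Mmono : {homo M : i j / (i <= j)%N} by apply: homo_leq => //; exact: leq_trans.
have yM i t : y i t != 0 -> (M i <= t < M i.+1)%N.
  have [yN yT _ _] := Hg (M i); move=> yt; apply/andP; split.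
    by rewrite leqNgt; apply: contra yt => /yN/eqP.
  rewrite ltnNge; apply: contra yt => Mt; apply/eqP/yT.
  by rewrite (leq_trans _ Mt)//= leq_maxr.
(* Makes the error [m0 / r] in [norm_block_average] at most [1/10]. *)
pose r := (10 * m0.+1)%N.
have r0 : (0 < r)%N by rewrite muln_gt0.
have r0' : 0 < r%:R :> R by rewrite ltr0n.
have zle : `|x + r%:R^-1 *: \sum_(i < r) y i| <= 3 / 2 + m0%:R / r%:R.
  apply: (norm_block_average r0 _ Mmono) => //; first exact: leq_maxr.
  by move=> i; have [] := Hg (M i).
set z := x + _ in zle.
have fz : 9 / 5 * c <= f z.
  rewrite dualD dualZ dual_sumE -[_ *: _]/(_ * _).
  have : 9 / 10 * c <= r%:R^-1 * \sum_(i < r) f (y i).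
    rewrite ler_pdivlMl// (_ : r%:R * _ = \sum_(i < r) 9 / 10 * c); last first.
      by rewrite sumr_const card_ord [LHS]mulr_natl.
    by apply: ler_sum => i _; have [] := Hg (M i).
  by move: fx; set u := f x; set v := _^-1 * _; lra.
have zN t : (t < Nc)%N -> z t = 0.
  move=> tN; rewrite tree_addE xN// add0r tree_scaleE tree_sumE big1 ?mulr0// => i _.
  apply/eqP; apply: contraT => /yM/andP[Mt _].
  have : (Nc <= t)%N by rewrite (leq_trans _ Mt)// (leq_trans _ (Mmono 0%N i isT))// leq_maxl.
  by rewrite leqNgt tN.
have := HNc z zN; have mr : m0%:R / r%:R <= 1 / 10 :> R.
  rewrite ler_pdivrMr// /r natrM mulrA div1r mulVf ?mul1r ?ler_nat//.
have : c * `|z| <= c * (8 / 5) by rewrite ler_pM2l//; apply: le_trans zle _; lra.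
by have := ler_norm (f z); lra.
Qed.

Lemma dual_tail_small f e : 0 < e ->
  exists N, forall x, (forall t, (t < N)%N -> x t = 0) -> `|f x| <= e * `|x|.
Proof.
move=> e0; pose c := `|f| + 1.
have c0 : 0 < c by rewrite ltr_wpDl.
have Q k : exists N, forall x, (forall t, (t < N)%N -> x t = 0) ->
    `|f x| <= (9 / 10) ^+ k * c * `|x|.
  elim: k => [|k IH].
    exists 0%N => x _; rewrite expr0 mul1r (le_trans (dual_bound _ _))//.
    by rewrite ler_wpM2r// lerDl.
  by rewrite exprS -mulrA; apply: dual_tail_contract; rewrite ?mulr_gt0 ?exprn_gt0//; lra.
have : (fun k => (9 / 10 : R) ^+ k) @ \oo --> (0 : R).
  by apply: cvg_expr; rewrite ger0_norm; lra.
move=> /cvgrPdist_le/(_ (e / c)); rewrite divr_gt0// => /(_ isT)[k _ Hk].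
have [N HN] := Q k; exists N => x xN; apply: (le_trans (HN x xN)).
rewrite ler_wpM2r//.
have := Hk k (leqnn k); rewrite /= sub0r normrN => h.
by rewrite -ler_pdivlMr//; apply: le_trans h; exact: ler_norm.
Qed.

(** The values of [phi] on the coordinate functionals give the vector [x]. Every [f] is approximated
    in norm by finite combinations of coordinate functionals, because its tails are small, and on
    those [phi] agrees with evaluation at [x]. *)
Lemma tree_space_reflexive : reflexive_space X.
Proof.
move=> phi.
have /choice[cs csE] : forall t, exists h : dual X, forall x, h x = x t.
  move=> t; apply: (@ex_dual _ _ _ 1) => // x; rewrite mul1r; exact: norm_coord.
have [x xE] : exists x : X, tree_fun x = (fun t => phi (cs t)).
  apply: (@tree_fun_bounded _ _ `|phi|) => w N ww.
  (* A functional of norm at most 1, with signs chosen so that [phi h] is exactly [ev w] of the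
     candidate; this bounds its norm by that of [phi]. *)
  pose h : dual X := \sum_(t < N) (w t * Num.sg (phi (cs t))) *: cs t.
  have hE z : h z = \sum_(t < N) w t * Num.sg (phi (cs t)) * z t.
    rewrite /h (big_morph (fun h : dual X => h z) (id1 := 0) (op1 := +%R))//.
    by apply: eq_bigr => t _; rewrite -csE.
  have h1 : `|h| <= 1.
    apply: dual_norm_le => z z1; rewrite hE; apply: le_trans z1.
    apply: le_trans (norm_ub z N ww); apply: le_trans (ler_norm_sum _ _ _) _.
    apply: ler_sum => t _; rewrite !normrM ger0_norm ?weight_ge0// -mulrA.
    rewrite ler_wpM2l ?weight_ge0// ler_piMl// normr_sg; by case: (_ == _).
  have <- : phi h = ev w (fun t => phi (cs t)) N.
    rewrite dual_sumE; apply: eq_bigr => t _.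
    by rewrite dualZ -[_ *: _]/(_ * _) -mulrA -normrEsg.
  apply: le_trans (ler_norm _) _; apply: le_trans (dual_bound _ _) _.
  by rewrite -[leRHS]mulr1 ler_wpM2l.
exists x => f; apply/eqP; rewrite -subr_eq0 -normr_le0.
apply/ler_addgt0Pr => e e0; rewrite add0r.
have d0 : 0 < `|phi| + `|x| + 1 by rewrite ltr_wpDl// addr_ge0.
have [N HN] := @dual_tail_small f (e / (`|phi| + `|x| + 1)) (divr_gt0 e0 d0).
set d := e / _ in HN; have d_ge0 : 0 <= d by rewrite ltW// divr_gt0.
have fT z : `|f (tail N z)| <= d * `|tail N z|.
  by apply: HN => t tN; rewrite tailE leqNgt tN mul0r.
pose h : dual X := \sum_(t < N) f (basis t) *: cs t.
have hE z : h z = f (z - tail N z).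
  rewrite /h (big_morph (fun h : dual X => h z) (id1 := 0) (op1 := +%R))//.
  rewrite sub_tail dual_sumE; apply: eq_bigr => t _; rewrite dualZ -csE.
  exact: mulrC.
have fh : `|f - h| <= d.
  apply: dual_norm_le => z z1; have -> : (f - h : dual X) z = f z - h z by [].
  rewrite hE -dualB subKr; apply: (le_trans (fT z)).
  rewrite -[leRHS]mulr1 ler_wpM2l// (le_trans _ z1)//; exact: norm_restr.
have -> : phi f - f x = phi (f - h) - f (tail N x).
  rewrite dualB [phi h](_ : _ = f (x - tail N x)); last first.
    rewrite sub_tail !dual_sumE; apply: eq_bigr => t _; rewrite !dualZ xE.
    exact: mulrC.
  by rewrite (dualB f) opprB [RHS]addrC [RHS]addrCA addKr.
apply: le_trans (ler_normB _ _) _.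
apply: (@le_trans _ _ (`|phi| * d + d * `|x|)).
  apply: lerD; first by apply: le_trans (dual_bound _ _) _; rewrite ler_wpM2l.
  by apply: (le_trans (fT x)); rewrite ler_wpM2l// norm_restr.
rewrite mulrC -mulrDr /d mulrAC ler_pdivrMr// ler_wpM2l ?(ltW e0)// lerDl//.
Qed.

End Basis.

(** * Closed subspaces of finite codimension *)

Section FiniteCodimension.
Context {R : realType} (V : normedModType R).
Implicit Types (Y : set V) (u v z : V).

Lemma closed_normP Y : closed Y <->
  (forall z, (forall e : R, 0 < e -> exists2 y, Y y & `|z - y| < e) -> Y z).
Proof.
split=> [cY z Hz|HY z Hz].
  apply: cY => B /nbhs_normP[e /= e0 eB].
  by have [y Yy zy] := Hz e e0; exists y; split => //; exact: eB.
apply: HY => e e0; have [|y [Yy zy]] := Hz (ball_ Num.norm z e).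
  by apply/nbhs_normP; exists e.
by exists y.
Qed.

Lemma linear_subspaceD Y u v : linear_subspace Y -> Y u -> Y v -> Y (u + v).
Proof. by move=> [_ lY] Yu Yv; rewrite -[u]scale1r; exact: lY. Qed.

Lemma linear_subspaceZ Y (a : R) u : linear_subspace Y -> Y u -> Y (a *: u).
Proof. by move=> [Y0 lY] Yu; rewrite -[_ *: _]addr0; exact: lY. Qed.

Lemma linear_subspaceB Y u v : linear_subspace Y -> Y u -> Y v -> Y (u - v).
Proof.
move=> lY Yu Yv; rewrite -scaleN1r; apply: (linear_subspaceD lY) => //.
exact: linear_subspaceZ.
Qed.

(** By homogeneity, [d] may be any positive lower bound for the distance from [v] to the closed set
    [Y]. *)
Lemma line_coordinate_bound Y v : linear_subspace Y -> closed Y -> ~ Y v ->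
  exists2 d : R, 0 < d & forall (a : R) y, Y y -> `|a| * d <= `|y + a *: v|.
Proof.
move=> lY /closed_normP cY nv.
have [d d0 Hd] : exists2 d : R, 0 < d & forall y, Y y -> d <= `|v - y|.
  apply: contrapT => no; apply: nv; apply: cY => e e0.
  apply: contrapT => no'; apply: no; exists e => // y Yy.
  by rewrite leNgt; apply/negP => vy; apply: no'; exists y.
exists d => // a y Yy; have [->|a0] := eqVneq a 0; first by rewrite normr0 mul0r.
have -> : y + a *: v = a *: (v - - (a^-1 *: y)).
  by rewrite opprK scalerDr scalerA mulfV// scale1r addrC.
rewrite normrZ ler_wpM2l// Hd// -scaleNr; exact: linear_subspaceZ.
Qed.

(** Along a sequence approximating [z], the coefficients of [v] are Cauchy by
    [line_coordinate_bound]. Subtracting the limit multiple of [v] from [z] leaves a limit of points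
    of [Y]. *)
Lemma closed_add_line Y v : linear_subspace Y -> closed Y -> ~ Y v ->
  closed [set u | exists2 y, Y y & exists a : R, u = y + a *: v].
Proof.
move=> lY cY nv; have [d d0 Hd] := line_coordinate_bound lY cY nv.
apply/closed_normP => z Hz.
have inv0 (m : nat) : 0 < m.+1%:R^-1 :> R by rewrite invr_gt0.
have /choice[g Hg] : forall m : nat, exists p : V * R,
    Y p.1 /\ `|z - (p.1 + p.2 *: v)| < m.+1%:R^-1.
  by move=> m; have [_ [y Yy [a ->]] h] := Hz _ (inv0 m); exists (y, a).
pose a m : R^o := (g m).2.
have adiff N m : (N <= m)%N -> `|a N - a m| * d <= 2 * N.+1%:R^-1.
  move=> Nm; have [YN hN] := Hg N; have [Ym hm] := Hg m.
  apply: (le_trans (Hd (a N - a m) _ (linear_subspaceB lY YN Ym))).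
  have -> : (g N).1 - (g m).1 + (a N - a m) *: v =
      (z - ((g m).1 + a m *: v)) - (z - ((g N).1 + a N *: v)).
    by rewrite scalerBl (opprB z) [RHS]addrC subrKA opprD [RHS]addrACA.
  apply: le_trans (ler_normB _ _) _.
  have : m.+1%:R^-1 <= N.+1%:R^-1 :> R by rewrite lef_pV2 ?posrE// ler_nat.
  move=> mN; apply: le_trans (lerD (ltW hm) (ltW hN)) _.
  by rewrite mulr_natl mulr2n lerD2r.
have ca : cvg (a @ \oo).
  apply: cauchy_cvg; apply: cauchy_exP => e e0.
  have e1 : 0 < 2 / (e * d) by rewrite divr_gt0// mulr_gt0.
  pose N := Num.truncn (2 / (e * d)).
  exists (a N); exists N => // m /= Nm; rewrite -ball_normE /=.
  rewrite -(ltr_pM2r d0); apply: le_lt_trans (adiff _ _ Nm) _.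
  rewrite ltr_pdivrMr// -ltr_pdivrMl ?mulr_gt0// mulrC.
  by rewrite truncnS_gt.
pose al : R^o := lim (a @ \oo).
exists (z - al *: v); last by exists al; rewrite subrK.
move/closed_normP : cY; apply => e e0.
have v1 : 0 < `|v| + 1 by rewrite ltr_wpDl.
have /cvgrPdist_lt/(_ (e / 2 / (`|v| + 1))) := ca.
rewrite !divr_gt0// => /(_ isT)[N1 _ HN1].
pose m := maxn N1 (Num.truncn (2 / e)).
have [Ym hm] := Hg m; exists (g m).1 => //.
have -> : z - al *: v - (g m).1 = (z - ((g m).1 + a m *: v)) - (al - a m) *: v.
  by rewrite scalerBl opprB opprD [z + (_ + _)]addrA subrKA [LHS]addrAC.
apply: le_lt_trans (ler_normB _ _) _; rewrite (splitr e) ltr_leD//.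
  apply: lt_trans hm _; rewrite invf_plt ?posrE ?divr_gt0// invf_div.
  apply: lt_le_trans (truncnS_gt _) _; by rewrite ler_nat ltnS leq_maxr.
have := HN1 m (leq_maxl _ _); rewrite /= -/al => /ltW h.
rewrite normrZ; apply: (@le_trans _ _ (`|al - a m| * (`|v| + 1))).
  by rewrite ler_wpM2l// lerDl.
by rewrite -ler_pdivlMr.
Qed.

(** [Q] behaves as a projection onto [Y] along finitely many vectors: what it removes is a finite
    sum of bounded functionals times fixed vectors, and these functionals vanish along weakly null
    sequences. The induction adds one spanning vector to [Y] at a time. *)
Lemma finite_codim_approx q (v : 'I_q -> V) Y : linear_subspace Y -> closed Y ->
  (forall x, exists2 y, Y y & exists a : 'I_q -> R, x = y + \sum_(i < q) a i *: v i) ->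
  exists Q : V -> V, [/\ forall (a : R) u w, Q (a *: u + w) = a *: Q u + Q w,
    exists M : R, forall u, `|Q u| <= M * `|u|, forall u, Y (Q u) &
    forall z : nat -> V, weakly_null z -> (z m - Q (z m)) @[m --> \oo] --> (0 : V)].
Proof.
elim: q v Y => [|q IH] v Y lY cY Yv.
  exists id; split => //; first by exists 1 => u; rewrite mul1r.
    by move=> u; have [y Yy [a]] := Yv u; rewrite big_ord0 addr0 => ->.
  move=> z _; under eq_fun do rewrite subrr; exact: cvg_cst.
pose v0 := v ord_max; pose v' i := v (widen_ord (leqnSn q) i).
have [Yv0|nYv0] := pselect (Y v0).
  apply: (IH v' Y) => // x; have [y Yy [a ->]] := Yv x.
  exists (y + a ord_max *: v0).
    by apply: (linear_subspaceD lY) => //; exact: linear_subspaceZ.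
  exists (fun i => a (widen_ord (leqnSn q) i)).
  by rewrite big_ord_recr/= -addrA [_ *: _ + _]addrC.
pose Y' := [set u | exists2 y, Y y & exists a : R, u = y + a *: v0].
have lY' : linear_subspace Y'.
  split; first by exists 0; [exact: lY.1|exists 0; rewrite scale0r addr0].
  move=> c _ _ [y Yy [a ->]] [y' Yy' [a' ->]].
  exists (c *: y + y'); first by apply: lY.2.
  by exists (c * a + a'); rewrite scalerDl scalerDr scalerA addrACA.
have Y'v x : exists2 y, Y' y & exists a : 'I_q -> R, x = y + \sum_(i < q) a i *: v' i.
  have [y Yy [a ->]] := Yv x.
  exists (y + a ord_max *: v0); first by exists y => //; exists (a ord_max).
  exists (fun i => a (widen_ord (leqnSn q) i)).
  by rewrite big_ord_recr/= -addrA [_ *: _ + _]addrC.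
have [Q [Ql [M QM] QY Qz]] := IH v' Y' lY' (closed_add_line lY cY nYv0) Y'v.
have [d d0 Hd] := line_coordinate_bound lY cY nYv0.
(* [p] is the coordinate of [Q x] along [v0]. It is unique because [v0] is outside [Y], hence
   linear, and bounded by [line_coordinate_bound]. *)
have /choice[p Hp] : forall x, exists a : R, Y (Q x - a *: v0).
  by move=> x; have [y Yy [a ->]] := QY x; exists a; rewrite addrK.
have uniq u a b : Y (u - a *: v0) -> Y (u - b *: v0) -> a = b.
  move=> Ya Yb; have Yab : Y ((b - a) *: v0).
    have -> : (b - a) *: v0 = (u - a *: v0) - (u - b *: v0).
      by rewrite scalerBl opprB [RHS]addrC addrA subrK.
    exact: linear_subspaceB.
  apply/eqP; rewrite eq_sym -subr_eq0; apply: contrapT => /negP ba; apply: nYv0.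
  by rewrite -[v0](scalerK ba); exact: linear_subspaceZ.
have pl (a : R) u w : p (a *: u + w) = a * p u + p w.
  apply: (uniq (Q (a *: u + w))) => //; rewrite Ql scalerDl -scalerA opprD addrACA.
  by rewrite -scalerBr; exact: lY.2.
have pM u : `|p u| <= M / d * `|u|.
  rewrite mulrAC ler_pdivlMr// (le_trans _ (QM u))//.
  by rewrite (le_trans (Hd (p u) _ (Hp u)))// subrK.
have [f fE] := ex_dual pl pM.
exists (fun u => Q u - p u *: v0); split => //.
- move=> a u w; rewrite pl Ql scalerDl -scalerA opprD addrACA.
  by rewrite -scalerBr.
- exists (M + M / d * `|v0|) => u; rewrite (le_trans (ler_normB _ _))// mulrDl.
  by rewrite lerD// normrZ mulrAC ler_wpM2r.
- move=> z z0; rewrite -[0]addr0.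
  have -> : (fun m => z m - (Q (z m) - p (z m) *: v0)) =
      (fun m => (z m - Q (z m)) + f (z m) *: v0).
    by apply/funext => m; rewrite opprB addrCA addrC fE.
  apply: cvgD; first exact: Qz.
  rewrite -(scale0r v0); apply: cvgZr_tmp; exact: z0.
Qed.

(** In finite dimension player (S) may play the zero subspace, which contains no normalized vector,
    and so wins vacuously. *)
Lemma infinite_dimensional_of_not_Asymptotic_l1 :
  ~ Asymptotic_l1 V -> infinite_dimensional V.
Proof.
move=> nA [n [v Hv]]; apply: nA; exists 1 => // k k0.
exists (fun=> [set 0]); split => [_|x Hx].
  split.
  - by split=> // a u w /= -> ->; rewrite scaler0 addr0.
  - apply/closed_normP => z Hz /=; apply/eqP; rewrite -normr_le0.
    apply/ler_addgt0Pr => e e0; rewrite add0r.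
    by have [_ -> /ltW] := Hz e e0; rewrite subr0.
  - exists n, v => x; exists 0 => //; have [a ->] := Hv x.
    by exists a; rewrite add0r.
have [+ x0] := Hx (Ordinal k0); rewrite x0 normr0 => /esym/eqP.
by rewrite oner_eq0.
Qed.

End FiniteCodimension.

(** * Asymptotic models and the game on the tree space *)

Section Main.
Context {R : realType}.
Local Notation X := (tree_space R).

Lemma weakly_null_coord (z : nat -> X) t : weakly_null z ->
  z j t @[j --> \oo] --> (0 : R^o).
Proof.
have [f fE] : exists f : dual X, forall x, f x = x t.
  apply: (@ex_dual _ _ _ 1) => // x; rewrite mul1r; exact: norm_coord.
by move=> /(_ f); under eq_fun do rewrite fE.
Qed.

Lemma basis_weakly_null : weakly_null (basis : nat -> X).
Proof.
move=> f; apply/cvgrPdist_le => e e0; have [N HN] := dual_tail_small f e0.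
exists N => // t /= Nt; rewrite sub0r normrN.
have := HN (basis t); rewrite basis_norm mulr1; apply => s sN.
by rewrite basisE ltn_eqF// (leq_trans sN).
Qed.

(** The upper estimate is the triangle inequality. For the lower one, weights norm unit vectors up
    to [1/2], so [norm_row_ge] gives the constant [1/8] at arbitrarily late positions, where the
    norm is close to that of the model. *)
Lemma tree_space_l1_model : unique_l1_asymptotic_model X.
Proof.
move=> x xnull E p e [pD pZ] gen; exists 8; first by rewrite (ler_nat R 1 8).
move=> n a; rewrite !l1_norm_unitE.
have x1 i j : `|x i j| = 1 by have [+ _] := xnull i; exact.
pose ext (b : 'I_n -> R) (i : nat) : R := oapp b 0 (insub i).
have extE b (i : 'I_n) : ext b i = b i by rewrite /ext valK.
have small (b : 'I_n -> R) (d : R) : 0 < d -> (forall i, `|b i| <= 1) ->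
    8^-1 * \sum_(i < n) `|b i| <= p (\sum_(i < n) b i *: e i) + d /\
    p (\sum_(i < n) b i *: e i) <= \sum_(i < n) `|b i| + d.
  move=> d0 b1; have [k0 Hk0] := gen d n d0.
  have [|||||k [kk0 kmono kge]] := @norm_row_ge R x (1 / 2) _ _ _ _ _ n k0.
  - by lra.
  - move=> i j; have [w [N [ww]]] := @norm_near _ (x i j) (1 / 2) ltac:(lra).
    by rewrite x1 => h; exists w, N; split => //; lra.
  - by move=> i j; rewrite x1.
  - by move=> i t; apply: weakly_null_coord; have [_] := xnull i.
  - by move=> i j d'; exact: tail_to0.
  have := Hk0 (fun i => k i) (fun i => kk0 i (ltn_ord i)) _ b.
  have -> : \sum_(i < n) b i *: x i (k i) = \sum_(i < n) ext b i *: x i (k i).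
    by apply: eq_bigr => i _; rewrite extE.
  move=> h; have {h} : `| `|\sum_(i < n) ext b i *: x i (k i)| -
      p (\sum_(i < n) b i *: e i) | < d.
    apply: h => [i j ij|i]; first by apply: kmono; rewrite ij ltn_ord.
    by rewrite -ler_norml.
  have := kge (ext b); have -> : \sum_(i < n) `|ext b i| = \sum_(i < n) `|b i|.
    by apply: eq_bigr => i _; rewrite extE.
  have : `|\sum_(i < n) ext b i *: x i (k i)| <= \sum_(i < n) `|b i|.
    apply: le_trans (ler_norm_sum _ _ _) _; apply: ler_sum => i _.
    by rewrite normrZ x1 mulr1 extE.
  rewrite ltr_norml; set A := `|\sum_(_ < _) _|; set B := \sum_(_ < _) _.
  by move=> h1 h2 /andP[h3 h4]; split; lra.
(* Asymptotic models speak only of coefficients in [[-1, 1]], so [a] is scaled down; the added 1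
   keeps [s] positive when [a] vanishes. *)
pose s := 1 + \sum_(i < n) `|a i|.
have s0 : 0 < s by rewrite ltr_pwDl// sumr_ge0.
pose b i := s^-1 * a i.
have b1 i : `|b i| <= 1.
  rewrite /b normrM normfV (gtr0_norm s0) ler_pdivrMl// mulr1 /s (bigD1 i)//=.
  by rewrite addrCA lerDl addr_ge0// sumr_ge0.
have bE : \sum_(i < n) `|b i| = s^-1 * \sum_(i < n) `|a i|.
  rewrite mulr_sumr; apply: eq_bigr => i _.
  by rewrite /b normrM normfV (gtr0_norm s0).
have pE : p (\sum_(i < n) b i *: e i) = s^-1 * p (\sum_(i < n) a i *: e i).
  rewrite -[s^-1 in RHS]gtr0_norm ?invr_gt0// -pZ scaler_sumr.
  by congr p; apply: eq_bigr => i _; rewrite scalerA.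
have si : 0 < s^-1 by rewrite invr_gt0.
have sum0 : 0 <= \sum_(i < n) `|a i| by rewrite sumr_ge0.
split.
  rewrite -(ler_pM2l si) -pE; apply/ler_addgt0Pr => d d0.
  by have [+ _] := small b d d0 b1; rewrite bE mulrCA.
apply: (@le_trans _ _ (\sum_(i < n) `|a i|)); last by lra.
rewrite -(ler_pM2l si) -pE -bE; apply/ler_addgt0Pr => d d0.
by have [_] := small b d d0 b1.
Qed.

(** Apply the map of [finite_codim_approx] to late unit vectors and normalize; approximating to
    within [d / 2] leaves [d / 2] for the normalization, and within [1/2] keeps the image away from
    zero. *)
Lemma finite_codim_near_basis (Y : set X) (d : R) : finite_codim_subspace Y -> 0 < d ->
  exists N, forall t, (N <= t)%N -> exists y, [/\ Y y, `|y| = 1 & `|y - basis t| <= d].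
Proof.
move=> [lY cY [q [v Yv]]] d0.
have [Q [_ _ QY /(_ _ basis_weakly_null)/cvgrPdist_le Qz]] := finite_codim_approx lY cY Yv.
have h0 : 0 < Num.min (d / 2) (1 / 2) by rewrite lt_min !divr_gt0.
have [N _ HN] := Qz _ h0; exists N => t Nt.
have := HN t Nt; rewrite /= sub0r normrN le_min => /andP[h1 h2].
set y := Q (basis t) in h1 h2 *.
have hy : `|1 - `|y| | <= `|basis t - y|.
  by rewrite -(basis_norm t : `|basis t : X| = 1) ler_dist_dist.
have y0 : 0 < `|y| by move: (le_trans hy h2); rewrite ler_norml => /andP[]; lra.
exists (`|y|^-1 *: y); split.
- by apply: linear_subspaceZ => //; exact: QY.
- by rewrite normrZ normfV normr_id mulVf ?gt_eqF.
rewrite -(subrK y (`|y|^-1 *: y)) -addrA (le_trans (ler_normD _ _))//.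
have -> : `| `|y|^-1 *: y - y| = `|1 - `|y| |.
  rewrite -[X in _ - X]scale1r -scalerBl normrZ -{2}[`|y|]normr_id -normrM mulrBl.
  by rewrite mulVf ?gt_eqF// mul1r.
by rewrite [d]splitr lerD ?(le_trans hy)// distrC.
Qed.

Lemma norm_chain (n : nat) (t : nat -> nat) :
  (forall i j, (i < j < n)%N -> (t i < t j)%N /\ t i \in ancestors (t j)) ->
  `|\sum_(i < n) (basis (t i) : X)| <= 1.
Proof.
move=> Ht; pose P : pred nat := fun s => [exists i : 'I_n, s == t i].
have HP s u : P s -> P u -> (s < u)%N -> s \in ancestors u.
  move=> /existsP[i /eqP ->] /existsP[j /eqP ->] tij.
  have [ij|ji|ij] := ltngtP i j.
  - by have [] := Ht i j; rewrite ?ij ?ltn_ord.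
  - have [] := Ht j i; first by rewrite ji ltn_ord.
    by move=> tji; move: (ltn_trans tij tji); rewrite ltnn.
  - by move: tij; rewrite ij ltnn.
apply: norm_le => w N ww; apply: le_trans (weight_chain N ww HP).
apply: ler_sum => s _; rewrite ler_wpM2l ?weight_ge0// tree_sumE.
under eq_bigr do rewrite basisE.
have [/existsP[i /eqP si]|] := boolP (P s); last first.
  rewrite negb_exists => /forallP ns; rewrite big1 ?normr0// => i _.
  by rewrite (negbTE (ns i)).
rewrite (bigD1 i)//= si eqxx big1 ?addr0 ?normr1// => j ji.
case: eqVneq => // tij; exfalso.
move: ji; rewrite -val_eqE/= neq_ltn => /orP[ij|ij].
  by have [] := Ht j i; rewrite ?ij ?ltn_ord// tij ltnn.
by have [] := Ht i j; rewrite ?ij ?ltn_ord// tij ltnn.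
Qed.

(** Player (V) answers with a vector of the offered subspace within [1/n] of a unit vector whose
    node is a level-[n] child of the previous node. The [n] nodes form a chain, so the sum of the
    vectors has norm at most [1 + 1], against the required [n / C > 2]. *)
Lemma tree_space_not_Asymptotic_l1 : ~ Asymptotic_l1 X.
Proof.
move=> [C C1 HC]; pose n := (Num.truncn (2 * C)).+1.
have [S [Scodim Swin]] := HC n isT.
have n0 : 0 < n%:R^-1 :> R by rewrite invr_gt0.
have /choice[g Hg] : forall p : seq X * nat, exists q : X * nat,
    [/\ S p.1 q.1, `|q.1| = 1, `|q.1 - basis q.2| <= n%:R^-1,
        parent q.2 = p.2 & level q.2 = n /\ (p.2 < q.2)%N].
  move=> [h t]; have [N HN] := finite_codim_near_basis (Scodim h) n0.
  have [y [Sy y1 yt]] := HN (child t n N) (child_ge _ _ _).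
  exists (y, child t n N); split => //=; first exact: parent_child.
  by rewrite level_child child_gt.
(* The state of the play: the vectors chosen so far and the last node, starting from the node 0. *)
pose H := fix H k := if k is k'.+1 then
  (rcons (H k').1 (g (H k')).1, (g (H k')).2) else ([::] : seq X, 0%N).
pose x k := (g (H k)).1; pose t k := (g (H k)).2.
have Hx k : (H k).1 = mkseq x k.
  by elim: k => //= k ->; rewrite -/(x k) /mkseq -[k.+1]addn1 iotaD map_cat cats1.
have tS k : parent (t k.+1) = t k by have [] := Hg (H k.+1).
have tlevel k : level (t k) = n by have [_ _ _ _ []] := Hg (H k).
have tlt k : (t k < t k.+1)%N by have [_ _ _ _ []] := Hg (H k.+1).
have titer k i : iter k parent (t (i + k)%N) = t i.
  by elim: k i => [|k IH] i; rewrite ?addn0// iterSr addnS tS.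
have tchain i j : (i < j < n)%N -> (t i < t j)%N /\ t i \in ancestors (t j).
  move=> /andP[ij jn]; split; first by apply: (homo_ltn ltn_trans tlt).
  (* Written as a successor to match [iter k.+1] in [ancestors]; fewer than [n] steps are taken,
     which is the cutoff on level [n]. *)
  have jE : j = (i + (j - i).-1.+1)%N by lia.
  have := titer (j - i).-1.+1 i; rewrite -jE => ti; rewrite -ti.
  by apply: mem_ancestors; rewrite ?ti !tlevel//; lia.
have size_x : size (mkseq x n) == n by rewrite size_mkseq.
have tn (i : 'I_n) : tnth (Tuple size_x) i = x i.
  by rewrite (tnth_nth (x 0%N))/= nth_mkseq.
have : C_equivalent C Num.norm l1_norm (tnth (Tuple size_x))
    (fun i : 'I_n => l1_unit i).
  apply: Swin => i; rewrite tn /= /mkseq -map_take take_iota (minn_idPl (ltnW (ltn_ord i))).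
  by rewrite -/(mkseq x i) -Hx; have [] := Hg (H i).
move=> /(_ (fun=> 1))[+ _]; rewrite l1_norm_unitE sumr_const normr1 card_ord.
move=> h; suff : `|\sum_(i < n) 1 *: tnth (Tuple size_x) i| <= 2.
  move=> /(le_trans h); rewrite ler_pdivrMl ?(lt_le_trans ltr01)// leNgt.
  by rewrite mulrC truncnS_gt.
have -> : \sum_(i < n) 1 *: tnth (Tuple size_x) i =
    \sum_(i < n) (x i - basis (t i)) + \sum_(i < n) basis (t i).
  by rewrite -big_split/=; apply: eq_bigr => i _; rewrite scale1r tn subrK.
apply: le_trans (ler_normD _ _) _; rewrite -[leRHS]/(1 + 1) lerD ?norm_chain//.
apply: le_trans (ler_norm_sum _ _ _) _.
apply: (@le_trans _ _ (\sum_(i < n) n%:R^-1)).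
  by apply: ler_sum => i _; have [] := Hg (H i).
by rewrite sumr_const card_ord -[_ *+ n]mulr_natl mulfV ?pnatr_eq0.
Qed.

End Main.

Theorem theorem1p2 (R : realType) :
  exists X : completeNormedModType R,
    [/\ infinite_dimensional X,
        reflexive_space X,
        exists b : nat -> X, unconditional_basis b,
        unique_l1_asymptotic_model X
      & ~ Asymptotic_l1 X].
Proof.
exists (tree_space R); split.
- apply: infinite_dimensional_of_not_Asymptotic_l1.
  exact: tree_space_not_Asymptotic_l1.
- exact: tree_space_reflexive.
- by exists basis; exact: basis_unconditional.
- exact: tree_space_l1_model.
- exact: tree_space_not_Asymptotic_l1.
Qed.
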